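(* Let $K_0$ be a perfect field of characteristic $p>0$ and $K$ a finitely generated field extension of $K_0$. Then for all $n,m\in\mathbb{N}_{\geq1}$, the formula $\pi_{n,p^m}$ is equivalent modulo $\mathrm{Th}_{\mathcal{L}_{\rm ring}}(K)$ to an existential $\mathcal{L}_{\rm ring}$-formula with at most one quantifier, i.e. $\mathrm{rk}^{\exists}_{\mathrm{Th}(K)}(\pi_{n,p^m})\leq 1$.
   Context: $\mathcal{L}_{\rm ring}=\{+,-,\cdot,0,1\}$ (no parameters). $\mathrm{Th}_{\mathcal{L}_{\rm ring}}(K)$ is the complete $\mathcal{L}_{\rm ring}$-theory of $K$. $\pi_{n,k}(X_1,\dots,X_n)$ denotes $\exists Y_1,\dots,Y_n\bigwedge_{i=1}^n X_i\doteq Y_i^k$. An existential formula with at most one quantifier means a formula $\exists Y\,\psi$ with $\psi$ quantifier-free (or a quantifier-free formula); equivalence modulo a theory $T$ means $T\models\forall\underline X(\varphi\leftrightarrow\psi)$. *)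

(* Defs.v *)
From HB Require Import structures.
From mathcomp Require Import all_boot all_order all_algebra.

Set Implicit Arguments.
Unset Strict Implicit.
Unset Printing Implicit Defensive.

Import GRing.Theory.

(* First-order logic over L_ring = {+, -, *, 0, 1}, in well-scoped de Bruijn
   form: the free variables of an element of [lterm n] or [lformula n] are
   among the n variables indexed by 'I_n, and a quantifier binds index 0 of its
   body, the remaining indices being shifted by one. *)
Inductive lterm (n : nat) : Type :=
| TVar of 'I_n
| TZero
| TOne
| TAdd of lterm n & lterm n
| TOpp of lterm n
| TMul of lterm n & lterm n.

Arguments TZero {n}.
Arguments TOne {n}.

Inductive lformula : nat -> Type :=
| FEq n : lterm n -> lterm n -> lformula n
| FTop n : lformula n
| FBot n : lformula n
| FNot n : lformula n -> lformula n
| FAnd n : lformula n -> lformula n -> lformula n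
| FOr n : lformula n -> lformula n -> lformula n
| FImp n : lformula n -> lformula n -> lformula n
| FEx n : lformula n.+1 -> lformula n
| FAll n : lformula n.+1 -> lformula n.

Arguments FTop {n}.
Arguments FBot {n}.

Definition lsentence := lformula 0.

Definition FIff n (f g : lformula n) : lformula n := FAnd (FImp f g) (FImp g f).

(* In [exs k f] the variables 0, ..., k - 1 of f are quantified and the
   variable k + i of f becomes the free variable i. *)
Fixpoint exs (k n : nat) : lformula (k + n) -> lformula n :=
  match k return lformula (k + n) -> lformula n with
  | 0 => id
  | k'.+1 => fun f => exs (FEx f : lformula (k' + n))
  end.

Fixpoint univ_closure (n : nat) : lformula n -> lsentence :=
  match n return lformula n -> lsentence with
  | 0 => id
  | n'.+1 => fun f => univ_closure (FAll f)
  end.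

Fixpoint qfree n (f : lformula n) : bool :=
  match f with
  | FEq _ _ _ | FTop _ | FBot _ => true
  | FNot _ f1 => qfree f1
  | FAnd _ f1 f2 | FOr _ f1 f2 | FImp _ f1 f2 => qfree f1 && qfree f2
  | FEx _ _ | FAll _ _ => false
  end.

Record lstructure := LStructure {
  carrier :> Type;
  szero : carrier;
  sone : carrier;
  sadd : carrier -> carrier -> carrier;
  sopp : carrier -> carrier;
  smul : carrier -> carrier -> carrier }.

Fixpoint teval (M : lstructure) n (v : 'I_n -> M) (t : lterm n) : M :=
  match t with
  | TVar i => v i
  | TZero => szero M
  | TOne => sone M
  | TAdd t1 t2 => sadd (teval v t1) (teval v t2)
  | TOpp t1 => sopp (teval v t1)
  | TMul t1 t2 => smul (teval v t1) (teval v t2)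
  end.

Definition env_cons (T : Type) n (x : T) (v : 'I_n -> T) : 'I_n.+1 -> T :=
  fun i => if unlift ord0 i is Some j then v j else x.

Fixpoint sat (M : lstructure) n (f : lformula n) : ('I_n -> M) -> Prop :=
  match f in lformula n return ('I_n -> M) -> Prop with
  | FEq _ t1 t2 => fun v => teval v t1 = teval v t2
  | FTop _ => fun _ => True
  | FBot _ => fun _ => False
  | FNot _ f1 => fun v => ~ sat f1 v
  | FAnd _ f1 f2 => fun v => sat f1 v /\ sat f2 v
  | FOr _ f1 f2 => fun v => sat f1 v \/ sat f2 v
  | FImp _ f1 f2 => fun v => sat f1 v -> sat f2 v
  | FEx _ f1 => fun v => exists x : M, sat f1 (env_cons x v)
  | FAll _ f1 => fun v => forall x : M, sat f1 (env_cons x v)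
  end.

Definition env_nil (T : Type) : 'I_0 -> T :=
  fun i => False_rect T (notF (ltn_ord i)).

Definition sat_sentence (M : lstructure) (s : lsentence) : Prop :=
  sat s (@env_nil M).

Definition ltheory := lsentence -> Prop.

Definition is_model (M : lstructure) (T : ltheory) : Prop :=
  forall s, T s -> sat_sentence M s.

Definition entails (T : ltheory) (s : lsentence) : Prop :=
  forall M : lstructure, is_model M T -> sat_sentence M s.

Definition equiv_mod (T : ltheory) n (f g : lformula n) : Prop :=
  entails T (univ_closure (FIff f g)).

Definition exists_form (r n : nat) (f : lformula n) : Prop :=
  exists k : nat, exists g : lformula (k + n),
    [/\ k <= r, qfree g & f = exs g].

(* rk^exists_T(f) <= r, the rank being the least number of quantifiers in an
   existential formula equivalent to f modulo T (infinite if there is none). *)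
Definition exrank_le (T : ltheory) n (f : lformula n) (r : nat) : Prop :=
  exists g : lformula n, exists_form r g /\ equiv_mod T f g.

Definition ring_lstructure (R : nzRingType) : lstructure :=
  @LStructure R 0%R 1%R +%R (@GRing.opp R) *%R.

Definition Th (R : nzRingType) : ltheory := sat_sentence (ring_lstructure R).

Definition texp n (t : lterm n) (k : nat) : lterm n := iter k (TMul t) TOne.

(* pi_{n,k}(X_1, ..., X_n): before quantification Y_i is the variable i and X_i
   the variable n + i. *)
Definition pi_formula (n k : nat) : lformula n :=
  @exs n n (\big[@FAnd (n + n)/FTop]_(i < n)
    FEq (TVar (rshift n i)) (texp (TVar (lshift n i)) k)).

Definition perfect_field (F : fieldType) : Prop :=
  forall p, p \in [pchar F]%R -> forall x : F, exists y : F, (y ^+ p)%R = x.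

(* The subfield of K generated by s over the image of K0. *)
Inductive gen_subfield (K0 K : fieldType) (iota : {rmorphism K0 -> K})
    (s : seq K) : K -> Prop :=
| gen_base (a : K0) : gen_subfield iota s (iota a)
| gen_elt (x : K) : x \in s -> gen_subfield iota s x
| gen_add (x y : K) : gen_subfield iota s x -> gen_subfield iota s y ->
    gen_subfield iota s (x + y)%R
| gen_opp (x : K) : gen_subfield iota s x -> gen_subfield iota s (- x)%R
| gen_mul (x y : K) : gen_subfield iota s x -> gen_subfield iota s y ->
    gen_subfield iota s (x * y)%R
| gen_inv (x : K) : gen_subfield iota s x -> gen_subfield iota s (x^-1)%R.

Definition fin_gen_ext (K0 K : fieldType) (iota : {rmorphism K0 -> K}) : Prop :=
  exists s : seq K, forall x : K, gen_subfield iota s x.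

(* Main.v *)
Require Import Defs.
From HB Require Import structures.
From mathcomp Require Import all_boot all_order all_algebra.
From mathcomp Require Import boolp.
From mathcomp Require classical_sets.
From mathcomp Require Import ring zify.

Set Implicit Arguments.
Unset Strict Implicit.
Unset Printing Implicit Defensive.

Import GRing.Theory.
Local Open Scope ring_scope.

(**
One quantifier suffices because there is a polynomial [g] over the prime field
such that, for all [x, w] in [K], [g(x, w)] is a [p]-th power only if [x] and
[w] are.  Since [g] commutes with Frobenius, the same holds for [p^m]-th powers,
and [exists Y, Y^(p^m) = g(X_1, g(X_2, ... g(X_n, 0)))] defines [pi_{n,p^m}].

Take [g = x xi^(3p) + w eta^p], where [xi = x + x^r], [eta = w + w^r'] and
[r], [r'] are large multiples of [p].  Let [b] run over a [p]-basis of [K]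
contained in a finite generating set and [D = d/db].  If [g(x, w)] is a [p]-th
power then [xi^(3p) D x + eta^p D w = 0].  Suppose [D x <> 0] and set
[f = D w / xi = - xi^(3p-1) D x / eta^p].  Let [L] be the field generated over
[K_0] by the other elements of the [p]-basis, so that [D] kills [L] and [K] is
finite separable over [L(b)].  Comparing the two expressions of [f] at every
valuation ring of [K] over [L] shows that [f x^i], for all [i] up to a bound
that grows with [r], has poles bounded independently of [x] and [w].  Such
elements form a finite-dimensional [L]-vector space, whereas [x] is
transcendental over [L] because [D x <> 0]: a contradiction once [r] is large.
*)

(** * Subfields and linear algebra over them *)

(** The shape of [g] comes from the valuation estimate. As r and r' are multiples of p, D xi = D x
    and D eta = D w, while at a pole of x the element xi behaves like x^r, which leaves room for the
    factors x^i. Where x and w are finite, only a zero of xi can hurt. If eta = xi^2 z with z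
    finite, differentiating leaves a factor xi in D w; otherwise xi^2 / eta is finite, and the
    second expression of f needs 2p factors xi among its 3p - 1. The exponent 3p is the least
    multiple of p that allows this.

    Perfectness of K_0 acts twice: it puts the constants inside K^p, so that D kills L, and it makes
    the p-th powers of a basis of K over K_0(p-basis) a basis again. This form of separability
    replaces traces and discriminants in all bounds on denominators.

    Finite dimension over L is obtained from two charts, with coordinates b and 1/b. On each one,
    elements without poles are integral over a polynomial ring and have bounded denominators in one
    fixed basis; matching the two expansions bounds the degrees of the coordinates. *)

Section SubfieldType.
Variables (K : fieldType) (S : divringClosed K).

(** Packs a subfield as a [fieldType], so that matrix kernels and the gcd and division of
    polynomials are available over the subfield itself. *)
Record subfield_of := SubfieldOf { subfield_val :> K; _ : subfield_val \in S }.

HB.instance Definition _ := [isSub for subfield_val].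
HB.instance Definition _ := [Choice of subfield_of by <:].
HB.instance Definition _ := [SubChoice_isSubIntegralDomain of subfield_of by <:].
HB.instance Definition _ := [SubIntegralDomain_isSubField of subfield_of by <:].

Definition subfield_inj : {rmorphism subfield_of -> K} := \val.

Lemma subfield_injP (a : subfield_of) : subfield_inj a \in S.
Proof. exact: valP. Qed.

Lemma polyOver_subfield (P : {poly K}) :
  P \is a polyOver S -> exists Q : {poly subfield_of}, P = map_poly subfield_inj Q.
Proof.
move/polyOverP=> hP; exists (\poly_(i < size P) SubfieldOf (hP i)).
apply/polyP=> i; rewrite coef_map coef_poly; case: ltnP => //= hi.
by rewrite nth_default.
Qed.

Lemma map_subfield_over (Q : {poly subfield_of}) :
  map_poly subfield_inj Q \is a polyOver S.
Proof. by apply/polyOverP=> i; rewrite coef_map subfield_injP. Qed.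

End SubfieldType.
Arguments subfield_inj {K S} : simpl never.

Section Gen.
Variable (K : fieldType).
Implicit Types (S : divringClosed K) (C : {pred K}) (J : seq K).

Definition gen_pred C J : {pred K} :=
  fun x => `[< forall S, {subset C <= S} -> {subset J <= S} -> x \in S >].

Lemma gen_closed C J : divring_closed (gen_pred C J).
Proof.
split; first by apply/asboolP => S _ _; exact: rpred1.
- move=> x y /asboolP hx /asboolP hy; apply/asboolP => S h1 h2.
  by apply: rpredB; [exact: hx | exact: hy].
- move=> x y /asboolP hx /asboolP hy; apply/asboolP => S h1 h2.
  by apply: rpred_div; [exact: hx | exact: hy].
Qed.

HB.instance Definition _ C J :=
  GRing.isDivringClosed.Build K (gen_pred C J) (gen_closed C J).

Definition gen C J : divringClosed K := gen_pred C J.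

Lemma gen_sub C J : {subset C <= gen C J}.
Proof. by move=> x Cx; apply/asboolP=> S h _; exact: h. Qed.

Lemma gen_mem C J : {subset J <= gen C J}.
Proof. by move=> x Jx; apply/asboolP=> S _; exact. Qed.

Lemma gen_min C J S :
  {subset C <= S} -> {subset J <= S} -> {subset gen C J <= S}.
Proof. by move=> hC hJ x /asboolP; apply. Qed.

Lemma gen_ind C J (P : K -> Prop) :
  P 1 -> (forall x y, P x -> P y -> P (x - y)) ->
  (forall x y, P x -> P y -> P (x / y)) ->
  (forall x, x \in C -> P x) -> (forall x, x \in J -> P x) ->
  forall x, x \in gen C J -> P x.
Proof.
move=> P1 PB Pd PC PJ x /asboolP hx.
pose Q : {pred K} := fun x => `[< P x >].
have cQ : divring_closed Q.
  split; first exact/asboolP.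
    by move=> u v /asboolP ? /asboolP ?; apply/asboolP/PB.
  by move=> u v /asboolP ? /asboolP ?; apply/asboolP/Pd.
pose S : divringClosed K := HB.pack_for (divringClosed K) Q
  (GRing.isDivringClosed.Build K Q cQ).
by apply/asboolP/(hx S) => u ?; apply/asboolP; [exact: PC|exact: PJ].
Qed.

Lemma gen_subset C C' J J' :
  {subset C <= gen C' J'} -> {subset J <= gen C' J'} ->
  {subset gen C J <= gen C' J'}.
Proof. exact: gen_min. Qed.

End Gen.

Section Linear.
Variable (K : fieldType).
Implicit Types (S : divringClosed K).

Definition span S (I : finType) (e : I -> K) : {pred K} :=
  fun z => `[< exists2 c : I -> K, (forall i, c i \in S) & z = \sum_i c i * e i >].

Definition indep S (I : finType) (u : I -> K) : Prop :=
  forall c : I -> K, (forall i, c i \in S) -> \sum_i c i * u i = 0 ->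
  forall i, c i = 0.

Lemma spanP S (I : finType) (e : I -> K) z :
  reflect (exists2 c : I -> K, (forall i, c i \in S) & z = \sum_i c i * e i)
          (z \in span S e).
Proof. exact: asboolP. Qed.

Lemma span_zmod S (I : finType) (e : I -> K) : zmod_closed (span S e).
Proof.
split; first by apply/spanP; exists (fun=> 0) => [i|];
  rewrite ?rpred0 // big1 // => i _; rewrite mul0r.
move=> x y /spanP[c hc ->] /spanP[d hd ->]; apply/spanP.
exists (fun i => c i - d i) => [i|]; first by rewrite rpredB.
by rewrite -sumrB; apply: eq_bigr => i _; rewrite mulrBl.
Qed.

HB.instance Definition _ S (I : finType) (e : I -> K) :=
  GRing.isZmodClosed.Build K (span S e) (span_zmod S e).

Lemma span_scale S (I : finType) (e : I -> K) a z :
  a \in S -> z \in span S e -> a * z \in span S e.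
Proof.
move=> ha /spanP[c hc ->]; apply/spanP; exists (fun i => a * c i) => [i|].
  exact: rpredM.
by rewrite mulr_sumr; apply: eq_bigr => i _; rewrite mulrA.
Qed.

Lemma span_mem S (I : finType) (e : I -> K) i : e i \in span S e.
Proof.
apply/spanP; exists (fun j => (j == i)%:R) => [j|]; first by rewrite rpred_nat.
rewrite (bigD1 i) //= eqxx mul1r big1 ?addr0 // => j /negbTE->.
by rewrite mul0r.
Qed.

Lemma span_sum S (I J : finType) (e : J -> K) (c u : I -> K) :
  (forall i, c i \in S) -> (forall i, u i \in span S e) ->
  \sum_i c i * u i \in span S e.
Proof. by move=> hc hu; apply: rpred_sum => i _; exact: span_scale. Qed.

Lemma span_trans S (I J : finType) (f : I -> K) (e : J -> K) :
  (forall i, f i \in span S e) -> {subset span S f <= span S e}.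
Proof. by move=> h z /spanP[c hc ->]; exact: span_sum. Qed.

(** The coordinates of the [u j] form a matrix with more rows than columns; a non-zero row of its
    left kernel is the relation. *)
Lemma steinitz S (I J : finType) (e : I -> K) (u : J -> K) :
  (#|I| < #|J|)%N -> (forall j, u j \in span S e) ->
  exists c : J -> K, [/\ forall j, c j \in S, exists j, c j != 0
                       & \sum_j c j * u j = 0].
Proof.
move=> ltIJ hu.
have /choice[a ha] : forall j, exists c : I -> K,
    (forall i, c i \in S) /\ u j = \sum_i c i * e i.
  by move=> j; case/spanP: (hu j) => c; exists c.
pose A : 'M[subfield_of S]_(#|J|, #|I|) :=
  \matrix_(j, i) SubfieldOf ((ha (enum_val j)).1 (enum_val i)).
have nk : kermx A != 0.
  by rewrite kermx_eq0 -row_leq_rank -ltnNge (leq_ltn_trans (rank_leq_col A)).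
have [k hk] : exists k, row k (kermx A) != 0.
  apply/existsP; apply: contraNT nk; rewrite negb_exists => /forallP h.
  by apply/eqP/row_matrixP=> k; rewrite row0; apply/eqP; rewrite -[_ == _]negbK.
pose v := row k (kermx A).
have vA : v *m A = 0 by rewrite -row_mul mulmx_ker row0.
exists (fun j => subfield_inj (v 0 (enum_rank j))); split.
- by move=> j; exact: subfield_injP.
- case/rV0Pn: hk => i hi; exists (enum_val i); rewrite enum_valK.
  by rewrite fmorph_eq0.
transitivity (\sum_i (\sum_j subfield_inj (v 0 (enum_rank j)) * a j i) * e i).
  under [RHS]eq_bigr do rewrite mulr_suml.
  rewrite exchange_big; apply: eq_bigr => j _ /=.
  rewrite (ha j).2 mulr_sumr; apply: eq_bigr => i _; exact: mulrA.
apply: big1 => i _; rewrite [X in X * _](_ : _ = 0) ?mul0r //.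
have /matrixP/(_ 0 (enum_rank i)) := vA; rewrite !mxE => /(congr1 (@subfield_inj K S)).
rewrite rmorph0 rmorph_sum => h; rewrite -[RHS]h
  (reindex_onto enum_val enum_rank) /=; last by move=> *; rewrite enum_rankK.
rewrite (eq_bigl xpredT) /=; last by move=> j; rewrite enum_valK eqxx.
by apply: eq_bigr => j _; rewrite enum_valK [A _ _]mxE /= enum_rankK.
Qed.

Lemma sum_option (I : finType) (F : option I -> K) :
  \sum_i F i = F None + \sum_i F (Some i).
Proof.
rewrite (bigD1 None) //=; congr (_ + _).
rewrite (reindex_omap Some id) /=; last by case.
by apply: eq_bigl => i; rewrite eqxx.
Qed.

Lemma indep_in_span S (I : finType) (u : I -> K) z (c : option I -> K) :
  indep S u -> (forall i, c i \in S) -> (exists i, c i != 0) ->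
  \sum_i c i * (if i is Some j then u j else z) = 0 -> z \in span S u.
Proof.
move=> iu hc [i hi]; rewrite sum_option /= => h.
have c0 : c None != 0.
  apply: contraTneq hi => c0; case: i => [i|]; last by rewrite c0 eqxx.
  move: h; rewrite c0 mul0r add0r => /(iu (fun i => c (Some i))) /= h.
  by rewrite h // eqxx.
have -> : z = \sum_i (- (c None)^-1 * c (Some i)) * u i.
  move/eqP: h; rewrite addr_eq0 => /eqP h.
  apply: (mulfI c0); rewrite h mulr_sumr -sumrN; apply: eq_bigr => j _.
  by rewrite mulNr mulNr mulrN !mulrA mulfV // mul1r.
apply: span_sum => [j|j]; last exact: span_mem.
by rewrite rpredM ?rpredN ?rpredV.
Qed.

(** Adjoining [z] to [u] at the index [None] gives more vectors than the spanning family has, hence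
    a relation, and independence of [u] forces [z] to occur in it. *)
Lemma indep_span S (I J : finType) (e : I -> K) (u : J -> K) :
  #|I| = #|J| -> (forall z, z \in span S e) -> indep S u ->
  forall z, z \in span S u.
Proof.
move=> cIJ he iu z.
have [|j|c [hc h0 h]] := @steinitz S I (option J) e (fun j => if j is Some i then u i else z).
- by rewrite card_option cIJ.
- exact: he.
exact: (indep_in_span iu hc h0 h).
Qed.

Lemma span_reduce S n (e : 'I_n.+1 -> K) (c : 'I_n.+1 -> K) k :
  (forall i, c i \in S) -> c k != 0 -> \sum_i c i * e i = 0 ->
  {subset span S e <= span S (e \o lift k)}.
Proof.
move=> hc ck h; apply: span_trans => i.
case: (unliftP k i) => [j ->|->]; first exact: (span_mem S (e \o lift k)).
have -> : e k = \sum_j (- (c k)^-1 * c (lift k j)) * (e \o lift k) j.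
  move: h; rewrite (bigD1_ord k) //= => /eqP; rewrite addr_eq0 => /eqP h.
  apply: (mulfI ck); rewrite h mulr_sumr -sumrN; apply: eq_bigr => j _.
  by rewrite mulNr mulNr mulrN !mulrA mulfV // mul1r.
apply: span_sum => j; last exact: span_mem.
by rewrite rpredM ?rpredN ?rpredV.
Qed.

Definition finite_over S := exists n, exists e : 'I_n -> K, forall z, z \in span S e.

Lemma finite_basis S : finite_over S ->
  exists n, exists e : 'I_n -> K, (forall z, z \in span S e) /\ indep S e.
Proof.
move=> fS.
pose Q n := `[< exists e : 'I_n -> K, forall z, z \in span S e >].
have exQ : exists n, Q n by case: fS => n hn; exists n; apply/asboolP.
case: (ex_minnP exQ) => n /asboolP[e he] minn; exists n, e; split=> //.
move=> c hc h i; apply/eqP/negPn/negP => ci.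
case: n e he minn c hc h i ci => [|n] e he minn c hc h i ci; first by case: i ci.
have /minn : Q n; last by rewrite ltnn.
apply/asboolP; exists (e \o lift i) => z.
exact: (span_reduce hc ci h).
Qed.

Lemma finite_tower S S' (I : finType) (f : I -> K) :
  {subset S' <= span S f} -> finite_over S' -> finite_over S.
Proof.
move=> hf [n [e he]].
pose g (k : 'I_#|{: 'I_n * I}|) := e (enum_val k).1 * f (enum_val k).2.
exists #|{: 'I_n * I}|, g => z; case/spanP: (he z) => c hc ->.
apply: rpred_sum => i _; case/spanP: (hf _ (hc i)) => d hd ->.
rewrite mulr_suml; apply: rpred_sum => j _.
rewrite -mulrA; apply: span_scale => //.
by rewrite mulrC; have := span_mem S g (enum_rank (i, j)); rewrite /g enum_rankK.
Qed.

Lemma powers_span S (R : {poly K}) x m : R \is a polyOver S -> R != 0 -> R.[x] = 0 ->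
  x ^+ m \in span S (fun i : 'I_(size R).-1 => x ^+ i).
Proof.
move=> /polyOverP hR R0 Rx; set k := (size R).-1; set u := fun i : 'I_k => _.
have ek : size R = k.+1 by rewrite prednK // size_poly_gt0.
have lc : R`_k != 0 by rewrite -lead_coefE lead_coef_eq0.
elim: m => [|m /spanP[c hc e]].
  have [k0|k0] := posnP k; last by have := span_mem S u (Ordinal k0); rewrite /u /=.
  have /size_poly1P[a a0 eR] : size R == 1 by rewrite ek k0.
  by move: Rx a0; rewrite eR hornerC => ->; rewrite eqxx.
rewrite exprSr e mulr_suml; apply: rpred_sum => i _; rewrite -mulrA.
apply: span_scale => //; rewrite /u -exprSr.
have := ltn_ord i; rewrite leq_eqVlt => /predU1P[ei|lti]; last first.
  exact: (span_mem S u (Ordinal lti)).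
rewrite ei; move: Rx; rewrite horner_coef ek big_ord_recr /= => /eqP.
rewrite addrC addr_eq0 => /eqP h.
have -> : x ^+ k = \sum_(i < k) - (R`_k)^-1 * R`_i * u i.
  apply: (mulfI lc); rewrite h mulr_sumr -sumrN; apply: eq_bigr => j _.
  by rewrite /u !mulNr mulrN !mulrA mulfV // mul1r.
apply: span_sum => j; last exact: span_mem.
by rewrite rpredM ?rpredN ?rpredV.
Qed.

End Linear.

(** * Derivations and p-bases *)

Section Derivations.
Variables (K : fieldType) (D : K -> K).

Definition derivation :=
  (forall x y, D (x + y) = D x + D y) /\ (forall x y, D (x * y) = D x * y + x * D y).

Hypothesis hD : derivation.

Lemma derD x y : D (x + y) = D x + D y. Proof. exact: hD.1. Qed.
Lemma derM x y : D (x * y) = D x * y + x * D y. Proof. exact: hD.2. Qed.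
Lemma der0 : D 0 = 0.
Proof. by apply: (addrI (D 0)); rewrite -derD !addr0. Qed.
Lemma der1 : D 1 = 0.
Proof. by apply: (addrI (D 1)); rewrite addr0 -{3}[1]mulr1 derM mulr1 mul1r. Qed.
Lemma der_sum (I : Type) (r : seq I) (P : pred I) F :
  D (\sum_(i <- r | P i) F i) = \sum_(i <- r | P i) D (F i).
Proof. by apply: big_morph; [exact: derD | exact: der0]. Qed.
Lemma derX x n : D (x ^+ n) = x ^+ n.-1 * D x *+ n.
Proof.
elim: n => [|n IH]; first by rewrite expr0 der1 mulr0n.
case: n IH => [|n] IH; first by rewrite expr1 expr0 mul1r.
by rewrite exprS derM IH /= [RHS]mulrS mulrnAr mulrA -exprS [D x * _]mulrC.
Qed.
Lemma derV x : D (x^-1) = - D x / x ^+ 2.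
Proof.
have [->|x0] := eqVneq x 0; first by rewrite invr0 der0 oppr0 mul0r.
apply: (mulfI x0); have := derM x x^-1; rewrite mulfV // der1.
move/eqP; rewrite eq_sym addrC addr_eq0 => /eqP ->.
by rewrite expr2; field.
Qed.
Lemma der_pchar p x : p \in [pchar K] -> D (x ^+ p) = 0.
Proof. by move=> h; rewrite derX -mulr_natr pcharf0 // mulr0. Qed.

End Derivations.

Section Frobenius.
Variables (K : fieldType) (p : nat) (chK : p \in [pchar K]).
Implicit Types (S C k : divringClosed K) (J : seq K).

Let p_pr : prime p. Proof. by case/andP: chK. Qed.
Let p_gt0 : (0 < p)%N. Proof. exact: prime_gt0. Qed.

Lemma frobD (x y : K) : (x + y) ^+ p = x ^+ p + y ^+ p.
Proof. by rewrite -!(pFrobenius_autE chK) rmorphD. Qed.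
Lemma frobB (x y : K) : (x - y) ^+ p = x ^+ p - y ^+ p.
Proof. by rewrite -!(pFrobenius_autE chK) rmorphB. Qed.
Lemma frob_sum (I : finType) (F : I -> K) : (\sum_i F i) ^+ p = \sum_i F i ^+ p.
Proof.
apply: (big_morph (fun x : K => x ^+ p)); first exact: frobD.
by rewrite expr0n gtn_eqF.
Qed.
Lemma frob_inj : injective (fun x : K => x ^+ p).
Proof.
move=> x y /= /eqP; rewrite -subr_eq0 -frobB expf_eq0 p_gt0 subr_eq0.
by move/eqP.
Qed.

Definition powp_pred (S : {pred K}) : {pred K} :=
  fun x => `[< exists2 y, y \in S & x = y ^+ p >].

Lemma powp_closed S : divring_closed (powp_pred S).
Proof.
split; first by apply/asboolP; exists 1; rewrite ?rpred1 ?expr1n.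
- move=> _ _ /asboolP[x hx ->] /asboolP[y hy ->]; apply/asboolP.
  by exists (x - y); rewrite ?rpredB ?frobB.
- move=> _ _ /asboolP[x hx ->] /asboolP[y hy ->]; apply/asboolP.
  by exists (x / y); rewrite ?rpred_div ?expr_div_n.
Qed.

HB.instance Definition _ S :=
  GRing.isDivringClosed.Build K (powp_pred S) (powp_closed S).
Definition powp S : divringClosed K := powp_pred S.

Lemma powpP S x : reflect (exists2 y, y \in S & x = y ^+ p) (x \in powp S).
Proof. exact: asboolP. Qed.

Definition full_pred : {pred K} := xpredT.
Lemma full_closed : divring_closed full_pred. Proof. by []. Qed.
HB.instance Definition _ :=
  GRing.isDivringClosed.Build K full_pred full_closed.
Definition Kp : divringClosed K := powp full_pred.

Lemma KpP x : reflect (exists y, x = y ^+ p) (x \in Kp).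
Proof.
by apply: (iffP (powpP _ _)) => [[y _ ->]|[y ->]]; exists y.
Qed.

Lemma Kp_frob x : x ^+ p \in Kp.
Proof. by apply/KpP; exists x. Qed.

Lemma powp_Kp S : {subset powp S <= Kp}.
Proof. by move=> x /powpP[y _ ->]; exact: Kp_frob. Qed.

Lemma horner_frob k (b : K) (P : {poly K}) :
  b ^+ p \in k -> P \is a polyOver k -> P.[b] ^+ p \in k.
Proof.
move=> hb /polyOverP hP; rewrite horner_coef frob_sum; apply: rpred_sum => i _.
rewrite exprMn exprAC; apply: rpredM; apply: rpredX => //; exact: hP.
Qed.

Lemma reduce_poly k (b : K) (P : {poly K}) : b ^+ p \in k ->
  P \is a polyOver k ->
  exists Q : {poly K}, [/\ Q \is a polyOver k, (size Q <= p)%N & P.[b] = Q.[b]].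
Proof.
move=> hb /polyOverP hP.
exists (\sum_(i < size P) (P`_i * (b ^+ p) ^+ (i %/ p))%:P * 'X^(i %% p)); split.
- apply: rpred_sum => i _; rewrite rpredM ?polyOverC ?rpredX ?polyOverX //.
  by apply: rpredM; [exact: hP | exact: rpredX].
- apply: (leq_trans (size_sum _ _ _)); apply/bigmax_leqP => i _.
  rewrite mul_polyC (leq_trans (size_scale_leq _ _)) // size_polyXn.
  exact: ltn_pmod.
rewrite horner_coef horner_sum; apply: eq_bigr => i _.
by rewrite !hornerE -exprM -mulrA -exprD mulnC -divn_eq.
Qed.

Lemma gen_cons (C : {pred K}) J b x : b ^+ p \in gen C J -> x \in gen C (b :: J) ->
  exists P : {poly K}, [/\ P \is a polyOver (gen C J), (size P <= p)%N & x = P.[b]].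
Proof.
move=> hb hx.
suff [P hP ->] : exists2 P : {poly K}, P \is a polyOver (gen C J) & x = P.[b].
  by have [Q [h1 h2 h3]] := reduce_poly hb hP; exists Q.
move: x hx; apply: gen_ind.
- by exists 1; rewrite ?rpred1 // hornerE.
- by move=> _ _ [P hP ->] [Q hQ ->]; exists (P - Q); rewrite ?rpredB // !hornerE.
- move=> _ _ [P hP ->] [Q hQ ->].
  have [->|Q0] := eqVneq Q.[b] 0.
    by exists 0; rewrite ?rpred0 // invr0 mulr0 horner0.
  exists (P * Q ^+ p.-1 * (Q.[b] ^+ p)^-1%:P).
    by rewrite !rpredM ?rpredX // polyOverC rpredV horner_frob.
  rewrite !hornerE -mulrA; congr (_ * _).
  by rewrite -[in X in _ * X](prednK p_gt0) exprS invfM mulrCA mulfV ?mulr1 // expf_neq0.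
- by move=> c hc; exists c%:P; rewrite ?hornerE // polyOverC gen_sub.
- move=> c; rewrite inE => /predU1P[->|hc].
    by exists 'X; rewrite ?hornerE // polyOverX.
  by exists c%:P; rewrite ?hornerE // polyOverC gen_mem.
Qed.

(** * Simple purely inseparable extensions of degree p *)

Section Simple.
Variables (k : divringClosed K) (b : K).
Hypotheses (hb : b ^+ p \in k) (nb : b \notin k).

Lemma frob_XsubC : ('X - b%:P) ^+ p = 'X^p - (b ^+ p)%:P :> {poly K}.
Proof.
have ch : p \in [pchar {poly K}] by rewrite pchar_poly.
by rewrite -(pFrobenius_autE ch) rmorphB /= !pFrobenius_autE polyC_exp.
Qed.

(** If [b] were a simple root of [P], the gcd of [P] with X^p - b^p = (X - b)^p would be X - b up to
    a constant. This gcd can be computed over [k], which would put [b] in [k]. *)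
Lemma deriv_root0 (P : {poly K}) :
  P \is a polyOver k -> P.[b] = 0 -> P^`().[b] = 0.
Proof.
move=> /polyOver_subfield[Q hQ] hP; apply/eqP/negPn/negP => nP.
pose R : {poly subfield_of k} := 'X^p - (SubfieldOf hb)%:P.
have hR : map_poly subfield_inj R = ('X - b%:P) ^+ p.
  by rewrite frob_XsubC rmorphB; congr (_ - _); [exact: map_polyXn | exact: map_polyC].
pose G := gcdp Q R.
have hG : map_poly subfield_inj G = gcdp P (('X - b%:P) ^+ p).
  by rewrite gcdp_map hR hQ.
have /dvdp_exp_XsubCP[n [_ en]] : map_poly subfield_inj G %| ('X - b%:P) ^+ p.
  by rewrite hG dvdp_gcdr.
have rG : root (map_poly subfield_inj G) b.
  by rewrite hG root_gcd !rootE hP eqxx horner_exp !hornerE subrr expr0n gtn_eqF.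
have n1 : n = 1%N.
  case: n en => [|[|n]] // en.
    by move: rG; rewrite (eqp_root en) expr0 rootE hornerC oner_eq0.
  have : ('X - b%:P) ^+ 2 %| P.
    apply: dvdp_trans (dvdp_gcdl P (('X - b%:P) ^+ p)); rewrite -hG (eqp_dvdr _ en).
    by rewrite dvdp_exp2l.
  case/dvdpP=> q hq; case/negP: nP; rewrite hq expr2 !derivM.
  by rewrite !(hornerD, hornerM) ?hornerN ?hornerX ?hornerC subrr !(mulr0, mul0r, addr0).
have sG : size G = 2.
  by rewrite -(size_map_poly subfield_inj) (eqp_size en) n1 expr1 size_XsubC.
move/rootP: rG; rewrite horner_coef size_map_poly sG big_ord_recl big_ord1 !coef_map expr0 mulr1.
move=> rG; have /eqP : subfield_inj G`_0 + subfield_inj G`_1 * b = 0 := rG.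
rewrite addrC addr_eq0 => /eqP h.
have g1 : subfield_inj G`_1 != 0.
  rewrite fmorph_eq0; have := lead_coef_eq0 G; rewrite lead_coefE sG /= => ->.
  by rewrite -size_poly_eq0 sG.
case/negP: nb; have -> : b = - subfield_inj G`_0 / subfield_inj G`_1.
  by rewrite -h mulrC mulKf.
by rewrite rpred_div ?rpredN ?subfield_injP.
Qed.

Lemma deriv_eq0_const (P : {poly K}) : (size P <= p)%N -> P^`() = 0 -> P = (P`_0)%:P.
Proof.
move=> sP dP; apply/polyP=> i; rewrite coefC; case: i => [|i] //=.
have /polyP/(_ i) := dP; rewrite coef_deriv coef0 => /eqP.
have [ltip|] := ltnP i.+1 p; last by move=> lep _; rewrite nth_default // (leq_trans sP).
rewrite -mulr_natr mulf_eq0 -(dvdn_pcharf chK) gtnNdvd // orbF.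
by move/eqP.
Qed.

(** By [deriv_root0] a relation may be differentiated, so induction on the degree makes the
    derivative zero; for size at most p only a constant is left, equal to its value at [b]. *)
Lemma indep_powers (P : {poly K}) :
  P \is a polyOver k -> (size P <= p)%N -> P.[b] = 0 -> P = 0.
Proof.
have [n] := ubnP (size P); elim: n P => // n IH P ltn hP sP hb0.
have [->//|P0] := eqVneq P 0.
have lt' : (size P^`() < size P)%N by exact: lt_size_deriv.
have dP : P^`() = 0.
  apply: IH; [exact: leq_trans lt' ltn | | exact: leq_trans (ltnW lt') sP | exact: deriv_root0].
  by apply/polyOverP=> i; rewrite coef_deriv rpredMn // (polyOverP hP).
by move: hb0; rewrite (deriv_eq0_const sP dP) hornerC => ->.
Qed.

(** Formal differentiation in [b] is well defined: polynomials over [k] with the same value at [b]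
    have derivatives with the same value there, by [deriv_root0] applied to their difference. *)
Lemma exists_derivation : (forall z, exists2 P : {poly K}, P \is a polyOver k & z = P.[b]) ->
  exists2 D : K -> K, derivation D &
    forall P : {poly K}, P \is a polyOver k -> D P.[b] = P^`().[b].
Proof.
move=> hK.
have /choice[Q hQ] : forall z, exists P : {poly K}, P \is a polyOver k /\ z = P.[b].
  by move=> z; case: (hK z) => P; exists P.
have eD (P : {poly K}) : P \is a polyOver k -> (Q P.[b])^`().[b] = P^`().[b].
  move=> hP; apply/eqP; rewrite -subr_eq0 -hornerN -hornerD -derivN -derivD.
  apply/eqP/deriv_root0; first by rewrite rpredB // (hQ _).1.
  by rewrite hornerD hornerN -(hQ _).2 subrr.
exists (fun z => (Q z)^`().[b]) => //; split=> x y.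
  rewrite [in LHS](hQ x).2 [in LHS](hQ y).2 -hornerD eD ?derivD ?hornerD //.
  by rewrite rpredD ?(hQ _).1.
rewrite [in LHS](hQ x).2 [in LHS](hQ y).2 -hornerM eD ?derivM ?hornerD ?hornerM //.
  by rewrite -!(hQ _).2.
by rewrite rpredM ?(hQ _).1.
Qed.

End Simple.

Lemma exists_pbasis (s : seq K) : (forall z, z \in gen Kp s) ->
  exists I : seq K, [/\ uniq I, forall z, z \in gen Kp I
    & forall b, b \in I -> b \notin gen Kp (rem b I)].
Proof.
move=> hs.
pose Q n := `[< exists I : seq K, [/\ uniq I, size I = n & forall z, z \in gen Kp I] >].
have exQ : exists n, Q n.
  exists (size (undup s)); apply/asboolP; exists (undup s); split=> //.
    exact: undup_uniq.
  move=> z; apply: (gen_subset (@gen_sub _ Kp (undup s)) _ (hs z)) => x hx.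
  by apply: gen_mem; rewrite mem_undup.
case: (ex_minnP exQ) => n /asboolP[I [uI sI hI]] minn; exists I; split=> //.
move=> b bI; apply/negP => hb.
have /minn : Q n.-1.
  apply/asboolP; exists (rem b I); split.
  - exact: rem_uniq.
  - by rewrite size_rem // sI.
  move=> z; apply: (gen_subset (@gen_sub _ Kp _) _ (hI z)) => x xI.
  have [->//|xb] := eqVneq x b.
  by apply: gen_mem; rewrite mem_rem_uniq // inE xb.
by rewrite -ltnS prednK ?ltnn // -sI; case: (I) bI.
Qed.

(** * Independence and differentiation along a p-basis *)

Section PBasis.
Variable I : seq K.
Hypotheses (uI : uniq I) (genI : forall z, z \in gen Kp I)
  (indI : forall b, b \in I -> b \notin gen Kp (rem b I)).

Let kb b := gen Kp (rem b I).

Let kb_p b x : x ^+ p \in kb b.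
Proof. exact/gen_sub/Kp_frob. Qed.

Let genI_perm b : b \in I -> forall z, z \in gen Kp (b :: rem b I).
Proof.
move=> bI z; apply: (gen_subset (@gen_sub _ Kp _) _ (genI z)) => x xI.
by apply: gen_mem; rewrite -(perm_mem (perm_to_rem bI)).
Qed.

Lemma exists_partial : exists D : K -> K -> K, forall b, b \in I ->
  derivation (D b) /\ forall P : {poly K}, P \is a polyOver (kb b) -> D b P.[b] = P^`().[b].
Proof.
suff /choice[D hD] : forall b, exists D, b \in I -> derivation D /\
    forall P : {poly K}, P \is a polyOver (kb b) -> D P.[b] = P^`().[b].
  by exists D.
move=> b.
have [bI|_] := boolP (b \in I); last by exists id.
have [|D hD1 hD2] := @exists_derivation (kb b) b (kb_p b b) (indI bI).
  by move=> z; have [P [? _ ?]] := gen_cons (kb_p b b) (genI_perm bI z); exists P.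
by exists D.
Qed.

Let gen_kb (C : divringClosed K) b J : {subset C <= Kp} -> b \notin J ->
  {subset J <= I} -> {subset gen C J <= kb b}.
Proof.
move=> CK bJ JI; apply: gen_min => x hx; first exact/gen_sub/CK.
apply: gen_mem; rewrite mem_rem_uniq // inE JI // andbT.
by apply: contraNneq bJ => <-.
Qed.

Lemma polyOver_sub (C C' : divringClosed K) (P : {poly K}) :
  {subset C <= C'} -> P \is a polyOver C -> P \is a polyOver C'.
Proof. by move=> h /polyOverP hP; apply/polyOverP=> i; exact: h. Qed.

(* Expand the coefficients in powers of one element of the p-basis at a time:
   these powers are independent over a field containing all the [v i]. *)
Lemma pbasis_descend (C : divringClosed K) J (T : finType) (l v : T -> K) :
  {subset C <= Kp} -> (forall b, b \in J -> b ^+ p \in C) -> uniq J ->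
  {subset J <= I} -> (forall i, l i \in gen C J) -> (forall i, v i \in Kp) ->
  \sum_i l i * v i = 0 -> (exists i, l i != 0) ->
  exists l' : T -> K, [/\ forall i, l' i \in C, exists i, l' i != 0
                       & \sum_i l' i * v i = 0].
Proof.
move=> CK; elim: J l => [|b J IH] l Jp uJ JI hl hv h0 [i0 hi0].
  exists l; split=> //; last by exists i0.
  by move=> i; apply: gen_min (hl i).
have {uJ} /andP[bJ uJ] := uJ.
have bC : b ^+ p \in gen C J by apply/gen_sub/Jp; rewrite mem_head.
have /choice[P hP] : forall i, exists P : {poly K},
    [/\ P \is a polyOver (gen C J), (size P <= p)%N & l i = P.[b]].
  by move=> i; exact: gen_cons.
have JI' : {subset J <= I} by move=> x xJ; apply: JI; rewrite inE xJ orbT.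
have bI : b \in I by apply: JI; rewrite mem_head.
pose Q := \sum_i P i * (v i)%:P.
have Q0 : Q = 0.
  apply: (@indep_powers (kb b) b (kb_p b b) (indI bI)).
  - apply: rpred_sum => i _; have [h1 _ _] := hP i.
    rewrite rpredM //; first exact: polyOver_sub (gen_kb CK bJ JI') h1.
    by rewrite polyOverC gen_sub.
  - apply: (leq_trans (size_sum _ _ _)); apply/bigmax_leqP => i _.
    rewrite mulrC mul_polyC (leq_trans (size_scale_leq _ _)) //.
    by have [] := hP i.
  rewrite horner_sum -[RHS]h0; apply: eq_bigr => i _.
  by rewrite hornerM hornerC; have [_ _ ->] := hP i.
have Pi0 : P i0 != 0.
  by apply: contraNneq hi0 => e; have [_ _ ->] := hP i0; rewrite e horner0.
pose m := (size (P i0)).-1.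
apply: (IH (fun i => (P i)`_m)) => //.
- by move=> c cJ; apply: Jp; rewrite inE cJ orbT.
- by move=> i; have [/polyOverP] := hP i.
- have /polyP/(_ m) := Q0; rewrite coef0 coef_sum => h; rewrite -[RHS]h.
  by apply: eq_bigr => i _; rewrite coefMC.
by exists i0; rewrite -lead_coefE lead_coef_eq0.
Qed.

(** MacLane's criterion for separability. A relation between the [u i ^+ p] has coefficients in
    S^p(J); [pbasis_descend] replaces them by coefficients in S^p, and taking p-th roots gives a
    relation between the [u i] themselves. *)
Lemma maclane (C0 : {pred K}) J (T : finType) (u : T -> K) :
  (forall x, x \in C0 -> exists2 y, y \in C0 & x = y ^+ p) ->
  uniq J -> {subset J <= I} ->
  indep (gen C0 J) u -> indep (gen C0 J) (fun i => u i ^+ p).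
Proof.
move=> perf uJ JI iu c hc h0 i; apply/eqP/negPn/negP => ci.
set S := gen C0 J in iu hc.
(* Perfectness enters here: the constants are p-th powers of constants, so [S] is generated by [J]
   over its own p-th powers. *)
have SS : {subset S <= gen (powp S) J}.
  apply: gen_subset => [x xC|]; last exact: gen_mem.
  apply: gen_sub; apply/powpP; have [y yC ->] := perf x xC.
  by exists y => //; exact: gen_sub.
have [||||l [hl [j lj] l0]] := @pbasis_descend (powp S) J T c
  (fun i => u i ^+ p) (@powp_Kp S) _ uJ JI _ _ h0.
- by move=> b bJ; apply/powpP; exists b => //; exact: gen_mem.
- by move=> j; exact: SS.
- by move=> j; exact: Kp_frob.
- by exists i.
have /choice[g hg] : forall i, exists y, y \in S /\ l i = y ^+ p.
  by move=> m; have /powpP[y] := hl m; exists y.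
case/eqP: lj; rewrite (hg j).2 (iu g) ?expr0n ?gtn_eqF //.
  by move=> m; exact: (hg m).1.
apply: frob_inj; rewrite /= frob_sum expr0n gtn_eqF //= -[RHS]l0.
by apply: eq_bigr => m _; rewrite exprMn (hg m).2.
Qed.

Variable D : K -> K -> K.
Hypothesis hD : forall b, b \in I ->
  derivation (D b) /\ forall P : {poly K}, P \is a polyOver (kb b) -> D b P.[b] = P^`().[b].

Lemma partial_kb b x : b \in I -> x \in kb b -> D b x = 0.
Proof.
move=> bI hx; have := (hD bI).2 x%:P; rewrite hornerC derivC horner0; apply.
by rewrite polyOverC.
Qed.

Lemma partial_self b : b \in I -> D b b = 1.
Proof.
move=> bI; have := (hD bI).2 'X; rewrite hornerX derivX hornerC; apply.
exact: polyOverX.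
Qed.

(** The elements of [J] are removed one at a time. With [x = P.[b]] of degree below p, [D b x = 0]
    says that the derivative of [P] vanishes at [b]; it is then zero by [indep_powers], and [x] no
    longer involves [b]. *)
Lemma partials0 (C : divringClosed K) J x : {subset C <= Kp} ->
  (forall b, b \in J -> b ^+ p \in C) -> uniq J -> {subset J <= I} ->
  x \in gen C J -> (forall b, b \in J -> D b x = 0) -> x \in C.
Proof.
move=> CK; elim: J x => [|b J IH] x Jp uJ JI hx h0; first exact: gen_min hx.
have {uJ} /andP[bJ uJ] := uJ.
have bC : b ^+ p \in gen C J by apply/gen_sub/Jp; rewrite mem_head.
have JI' : {subset J <= I} by move=> y yJ; apply: JI; rewrite inE yJ orbT.
have bI : b \in I by apply: JI; rewrite mem_head.
have [P [hP sP eP]] := gen_cons bC hx.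
have hPk := polyOver_sub (gen_kb CK bJ JI') hP.
have dP : P^`() = 0.
  apply: (@indep_powers (kb b) b (kb_p b b) (indI bI)).
  - by apply/polyOverP=> i; rewrite coef_deriv rpredMn // (polyOverP hPk).
  - have [->|P0] := eqVneq P 0; first by rewrite derivC size_poly0.
    exact: leq_trans (ltnW (lt_size_deriv P0)) sP.
  - by rewrite -(hD bI).2 // -eP h0 // mem_head.
apply: IH => //.
- by move=> c cJ; apply: Jp; rewrite inE cJ orbT.
- by rewrite eP (deriv_eq0_const sP dP) hornerC (polyOverP hP).
- by move=> c cJ; apply: h0; rewrite inE cJ orbT.
Qed.

Lemma partials_Kp x : (forall b, b \in I -> D b x = 0) -> x \in Kp.
Proof.
by apply: partials0 (genI x) => // b _; exact: Kp_frob.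
Qed.

(** Suppose [x] is algebraic over [L], of degree k. The first k powers of [x] are independent, and
    by [maclane] so are their p-th powers; these k independent elements lie in the span of k powers,
    so [x] is a combination of them. But [D b] kills both [L] and p-th powers, hence [x]. *)
Lemma partial_transc (C0 : {pred K}) b x (P : {poly K}) :
  (forall x, x \in C0 -> exists2 y, y \in C0 & x = y ^+ p) -> b \in I ->
  D b x != 0 -> P \is a polyOver (gen C0 (rem b I)) -> P.[x] = 0 -> P = 0.
Proof.
move=> perf bI Dx hP Px; apply/eqP/negPn/negP => P0.
set L := gen C0 (rem b I) in hP.
have LK : {subset L <= kb b}.
  apply: gen_subset => [y yC|]; last exact: gen_mem.
  by have [z _ ->] := perf y yC; exact: kb_p.
pose Q n := `[< exists P : {poly K}, [/\ P \is a polyOver L, P.[x] = 0, P != 0 & size P = n] >].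
have exQ : exists n, Q n by exists (size P); apply/asboolP; exists P.
case: (ex_minnP exQ) => n /asboolP[R [hR Rx R0 sR]] minn.
pose k := n.-1; have ek : k.+1 = n by rewrite prednK // -sR size_poly_gt0.
pose u (i : 'I_k) := x ^+ i.
have iu : indep L u.
  move=> c hc h0 i; apply/eqP/negPn/negP => ci.
  pose R' := \poly_(j < k) (if insub j is Some j' then c j' else 0).
  have eR (j : 'I_k) : R'`_j = c j.
    by rewrite coef_poly ltn_ord valK.
  have /minn : Q (size R').
    apply/asboolP; exists R'; split=> //.
    - apply/polyOverP=> j; rewrite coef_poly; case: ifP => _; last exact: rpred0.
      by case: insubP => *; rewrite ?rpred0.
    - rewrite (@horner_coef_wide _ k) ?size_poly // -[RHS]h0.
      by apply: eq_bigr => j _; rewrite eR.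
    - by apply: contraNneq ci => e; rewrite -eR e coef0.
  by rewrite -ek ltnNge size_poly.
have hx m : x ^+ m \in span L u.
  by have := powers_span m hR R0 Rx; rewrite /u /k -sR.
have iup : indep L (fun i => u i ^+ p).
  apply: maclane => //; first exact: rem_uniq.
  by move=> y; apply: mem_rem.
have [|j|c [hc h0 h]] := @steinitz _ L 'I_k (option 'I_k) u
  (fun j => if j is Some i then u i ^+ p else x).
- by rewrite card_option.
- by case: j => [j|]; [rewrite /u -exprM | have := hx 1%N; rewrite expr1].
have /spanP[d hd ex] := indep_in_span iup hc h0 h.
case/eqP: Dx; have dD := (hD bI).1; rewrite ex (der_sum dD) big1 // => i _.
by rewrite (derM dD) (der_pchar dD _ chK) mulr0 addr0 (partial_kb bI) ?mul0r ?LK.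
Qed.

End PBasis.
End Frobenius.

(** * Valuation rings and integrality *)

Section ValuationRings.
Variable K : fieldType.

Definition valring (V : subringClosed K) := forall z, z \in V \/ z^-1 \in V.

(** * Chevalley's construction of valuation rings *)

Section Chevalley.
Variables (R : subringClosed K) (u : K).
Hypothesis u0 : u != 0.

(* Subrings of [K] containing [R] and [u^-1] but not [u]; a maximal one is a valuation ring. *)
Let good (A : K -> Prop) := [/\ forall x, x \in R -> A x,
  forall x y, A x -> A y -> A (x - y), forall x y, A x -> A y -> A (x * y),
  A u^-1 & ~ A u].

Let adj (A : K -> Prop) z x :=
  exists2 P : {poly K}, (forall i, A P`_i) & x = P.[z].

Let good0 A : good A -> A 0. Proof. by case=> h _ _ _ _; apply: h; exact: rpred0. Qed.
Let good1 A : good A -> A 1. Proof. by case=> h _ _ _ _; apply: h; exact: rpred1. Qed.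

Let adj_sub A z x : A 0 -> A x -> adj A z x.
Proof.
move=> A0 Ax; exists x%:P; last by rewrite hornerC.
by move=> i; rewrite coefC; case: ifP.
Qed.

Let adj_self A z : A 0 -> A 1 -> adj A z z.
Proof.
move=> A0 A1; exists 'X; last by rewrite hornerX.
by move=> i; rewrite coefX; case: (i == 1%N).
Qed.

Let ringA (A : K -> Prop) := [/\ A 0, A 1, forall x y, A x -> A y -> A (x - y) & 
  forall x y, A x -> A y -> A (x * y)].

Let ringA_sum A (I : Type) (r : seq I) (P : pred I) (F : I -> K) : ringA A ->
  (forall i, P i -> A (F i)) -> A (\sum_(i <- r | P i) F i).
Proof.
case=> A0 _ AB _ h; apply: big_ind => // x y Ax Ay.
by rewrite -[y]opprK; apply: (AB) => //; rewrite -sub0r; apply: (AB).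
Qed.

Let ring_adj A z : ringA A -> ringA (adj A z).
Proof.
move=> rA; have [A0 A1 AB AM] := rA; split; try exact: adj_sub.
- move=> _ _ [P hP ->] [Q hQ ->]; exists (P - Q); last by rewrite !hornerE.
  by move=> i; rewrite coefB; apply: (AB).
- move=> _ _ [P hP ->] [Q hQ ->]; exists (P * Q); last by rewrite !hornerE.
  by move=> i; rewrite coefM; apply: ringA_sum => // j _; apply: (AM).
Qed.

Let good_adj A z : good A -> ~ adj A z u -> good (adj A z).
Proof.
move=> gA nu; have [AR AB AM Au nAu] := gA.
have rA : ringA A by split=> //; [exact: good0 | exact: good1].
have [_ _ h1 h2] := ring_adj z rA.
by split=> //; [move=> x /AR|]; apply: adj_sub => //; exact: good0.
Qed.

Let integral := exists n (r : 'I_n -> K),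
  (forall i, r i \in R) /\ u ^+ n = \sum_(i < n) r i * u ^+ i.

(** Multiplying [u = P.[u^-1]] by [u ^+ m], with m the degree of [P], gives an integral equation of
    degree m + 1 for [u] over [R]. *)
Let base_good : ~ integral -> good (adj (fun x => x \in R) u^-1).
Proof.
move=> nI; have rR : ringA (fun x => x \in R).
  by split; [exact: rpred0 | exact: rpred1 | exact: rpredB | exact: rpredM].
have [_ _ h1 h2] := ring_adj u^-1 rR; have [R0 R1 _ _] := rR; split=> //.
- by move=> x; exact: adj_sub.
- exact: adj_self.
case=> P hP eP; apply: nI; exists (size P), (fun i => P`_(size P - i.+1)); split=> //.
case sP: (size P) => [|m].
  move/eqP: sP; rewrite size_poly_eq0 => /eqP P0.
  by move: u0; rewrite eP P0 horner0 eqxx.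
rewrite exprS {1}eP horner_coef sP mulr_suml (reindex_inj rev_ord_inj) /=.
apply: eq_bigr => i _; rewrite subSS -mulrA; congr (_ * _).
have im : (i <= m)%N by rewrite -ltnS.
have -> : u ^+ m = u ^+ (m - i) * u ^+ i by rewrite -exprD subnK.
by rewrite mulrA -exprMn mulVf // expr1n mul1r.
Qed.

Let maximal_good : ~ integral -> exists2 A, good A &
  forall B, good B -> (forall x, A x -> B x) -> forall x, B x -> A x.
Proof.
move=> /base_good; set B0 := adj _ _ => gB.
(* The union with [B0] lets the empty chain pass the test as well: it yields [B0] itself. *)
pose Q (A : K -> Prop) := good (fun x => A x \/ B0 x).
have [] := @classical_sets.Zorn_bigcup K Q.
  move=> F FQ Ft; rewrite /Q.
  have two x y : ((classical_sets.bigcup F id) x \/ B0 x) ->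
      ((classical_sets.bigcup F id) y \/ B0 y) ->
      B0 x /\ B0 y \/ exists2 A, F A & (A x \/ B0 x) /\ (A y \/ B0 y).
    case=> [[A FA Ax]|hx] [[A' FA' Ay]|hy]; last by left.
    - have [h|h] := Ft _ _ FA FA'; right; [exists A'|exists A] => //; split; left => //; exact: h.
    - by right; exists A => //; split; [left|right].
    - by right; exists A' => //; split; [right|left].
  have [g1 g2 g3 g4 g5] := gB; split.
  - by move=> x /g1; right.
  - move=> x y hx hy; case: (two x y hx hy) => [[Bx By]|[A FA [Ax Ay]]].
      by right; apply: g2.
    have [_ h _ _ _] := FQ _ FA; case: (h x y Ax Ay); last by right.
    by left; exists A.
  - move=> x y hx hy; case: (two x y hx hy) => [[Bx By]|[A FA [Ax Ay]]].
      by right; apply: g3.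
    have [_ _ h _ _] := FQ _ FA; case: (h x y Ax Ay); last by right.
    by left; exists A.
  - by right.
  - by case=> // -[A FA Au]; have [_ _ _ _ h] := FQ _ FA; apply: h; left.
move=> A [QA maxA]; exists (fun x => A x \/ B0 x) => // B gB' AB x Bx.
apply: contrapT => nx; apply: (maxA B).
  split; first by move=> y Ay; apply: (AB); left.
  by move=> h; apply: nx; left; apply: h.
rewrite /Q; have -> : (fun x => B x \/ B0 x) = B; last by [].
by apply/funext=> y; apply/propext; split; [case=> // ?; apply: (AB); right | left].
Qed.

Section Max.
Variable A : K -> Prop.
Hypothesis (gA : good A)
  (maxA : forall B, good B -> (forall x, A x -> B x) -> forall x, B x -> A x).

Let rA : ringA A.
Proof. by have [*] := gA; split=> //; [exact: good0 | exact: good1]. Qed.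

Let nAu : ~ A u. Proof. by case: gA. Qed.

Let adj_u z : ~ A z -> adj A z u.
Proof.
move=> nz; apply: contrapT => nu; apply: nz.
have [A0 A1 _ _] := rA.
apply: (maxA (good_adj gA nu)); last exact: adj_self.
by move=> x; apply: adj_sub.
Qed.

Let AD x y : A x -> A y -> A (x + y).
Proof.
have [A0 A1 AB _] := rA; move=> Ax Ay.
by rewrite -[y]opprK; apply: (AB) => //; rewrite -sub0r; apply: (AB).
Qed.

Let AX x n : A x -> A (x ^+ n).
Proof.
have [A0 A1 _ AM] := rA; move=> Ax.
by elim: n => [|n IH]; rewrite ?expr0 ?exprS //; apply: (AM).
Qed.

(** Otherwise maximality makes [u] a polynomial in the inverse of [s = 1 - a / u], so [u * s ^+ N]
    lies in [A] for some N. As [s ^+ N] again has the form [1 - a' / u], this puts [u] in [A]. *)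
Let unit_sub a : A a -> A (1 - a / u)^-1.
Proof.
move=> Aa; apply: contrapT => /adj_u[P hP eP].
have [A0 A1 AB AM] := rA; have [_ _ _ Aiu _] := gA.
set s := 1 - a / u in eP.
have s0 : s != 0.
  apply/eqP=> e; apply: nAu; move/eqP: e; rewrite subr_eq0 => /eqP e.
  by have -> : u = a by rewrite -[a](divfK u0) -e mul1r.
have hs m : exists2 a', A a' & s ^+ m = 1 - a' / u.
  elim: m => [|m [a' Aa' e]]; first by exists 0; rewrite // mul0r subr0.
  exists (a' + a - a' * a * u^-1);
    first by apply: (AB); [exact: AD | apply: (AM) => //; apply: (AM)].
  by rewrite exprSr e /s; field.
have As : A s by apply: (AB) => //; apply: (AM).
have [a' Aa' e] := hs (size P); apply: nAu.
have -> : u = u * s ^+ size P + a' by rewrite e; field.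
apply: (AD) => //; rewrite eP horner_coef mulr_suml; apply: ringA_sum => // i _.
rewrite -mulrA; apply: (AM) => //.
have ile : (i <= size P)%N by rewrite ltnW.
have -> : s ^+ size P = s ^+ (size P - i) * s ^+ i by rewrite -exprD subnK.
by rewrite mulrCA -exprMn mulVf // expr1n mulr1; apply: (AX).
Qed.

(** Let q be the constant coefficient of [Q]. By [unit_sub] the element 1 - q / u is a unit of [A],
    so [Q.[z^-1] = u] can be solved to write 1 as an [A]-combination of negative powers of [z].
    Multiplying the leading term of [P] by this combination lowers the degree. *)
Let step z (P Q : {poly K}) : z != 0 -> (forall i, A P`_i) -> (forall i, A Q`_i) ->
  P.[z] = u -> Q.[z^-1] = u -> (size Q <= size P)%N ->
  exists P' : {poly K}, [/\ forall i, A P'`_i, P'.[z] = u & (size P' < size P)%N].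
Proof.
move=> z0 hP hQ eP eQ sQP; have [A0 A1 AB AM] := rA; have [_ _ _ Aiu _] := gA.
case sQ: (size Q) => [|m].
  by move/eqP: sQ; rewrite size_poly_eq0 => /eqP Q0; move: u0; rewrite -eQ Q0 horner0 eqxx.
case sP: (size P) => [|n]; first by rewrite sP sQ in sQP.
have mn : (m <= n)%N by rewrite sP sQ in sQP.
set s := 1 - Q`_0 / u.
have As : A s^-1 by exact: unit_sub.
have s0 : s != 0.
  apply/eqP=> e; apply: nAu; move/eqP: e; rewrite subr_eq0 => /eqP e.
  by have -> : u = Q`_0 by rewrite -[Q`_0](divfK u0) -e mul1r.
pose c j := Q`_(j.+1) / s / u.
have h1 : \sum_(j < m) c j * z ^- j.+1 = 1.
  have e : u - Q`_0 = \sum_(j < m) Q`_(j.+1) * z^-1 ^+ j.+1.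
    by rewrite -eQ horner_coef sQ big_ord_recl expr0 mulr1 addrAC subrr add0r.
  apply: (mulfI (mulf_neq0 s0 u0)).
  have su : s * u = \sum_(j < m) Q`_(j.+1) * z^-1 ^+ j.+1.
    by rewrite -e /s mulrBl mul1r divfK.
  rewrite mulr1 [RHS]su mulr_sumr.
  by apply: eq_bigr => j _; rewrite /c exprVn /=; field; rewrite s0 u0 /= expf_neq0.
have Ac j : A (c j) by apply: (AM) => //; apply: (AM).
exists (take_poly n P + \sum_(j < m) (P`_n * c j)%:P * 'X^(n - j.+1)); split.
- move=> i; rewrite coefD coef_take_poly coef_sum; apply: (AD); first by case: ifP.
  apply: ringA_sum => // j _; rewrite coefCM coefXn; apply: (AM); first exact: AM.
  by case: (_ == _).
- rewrite hornerD horner_sum -[RHS]eP -[in RHS](poly_take_drop n P) hornerD; congr (_ + _).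
  have -> : drop_poly n P = (P`_n)%:P.
    by apply/polyP=> i; rewrite coef_drop_poly coefC;
      case: i => //= i; rewrite nth_default // sP addSn ltnS leq_addl.
  rewrite hornerM hornerC hornerXn -[RHS]mulr1 -h1 mulr_sumr; apply: eq_bigr => j _.
  rewrite hornerM hornerC hornerXn.
  have jn : (j < n)%N by rewrite (leq_trans (ltn_ord j)).
  have -> : z ^+ n = z ^+ (n - j.+1) * z ^+ j.+1 by rewrite -exprD subnK.
  by move: (c j) (z ^+ (n - _)) (z ^+ j.+1) (expf_neq0 j.+1 z0) => a1 a2 a3 a30; field.
- rewrite ltnS; apply: (leq_trans (size_polyD _ _)); rewrite geq_max size_take_poly.
  apply: (leq_trans (size_sum _ _ _)); apply/bigmax_leqP => j _.
  rewrite mul_polyC (leq_trans (size_scale_leq _ _)) // size_polyXn.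
  have := ltn_ord j; lia.
Qed.

Lemma maximal_valring z : A z \/ A z^-1.
Proof.
have [->|z0] := eqVneq z 0; first by left; case: rA.
apply: contrapT => nz.
have /adj_u[P hP eP] : ~ A z by move=> h; apply: nz; left.
have /adj_u[Q hQ eQ] : ~ A z^-1 by move=> h; apply: nz; right.
have [N] := ubnP (size P + size Q).
elim: N P Q hP hQ eP eQ => // N IH P Q hP hQ eP eQ leN.
have [le|lt] := leqP (size Q) (size P).
  have [P' [h1 h2 h3]] := step z0 hP hQ (esym eP) (esym eQ) le.
  by apply: (IH P' Q) => //; lia.
have eP' : P.[z^-1^-1] = u by rewrite invrK.
have [Q' [h1 h2 h3]] := step (invr_neq0 z0) hQ hP (esym eQ) eP' (ltnW lt).
by apply: (IH P Q') => //; lia.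
Qed.

End Max.

Lemma integral_of_valrings0 :
  (forall V, valring V -> {subset R <= V} -> u \in V) -> integral.
Proof.
move=> h; apply: contrapT => /maximal_good[A gA maxA].
pose Q : {pred K} := fun x => `[< A x >].
have [AR AB AM Au nAu] := gA.
have cQ : subring_closed Q.
  split; first exact/asboolP/(good1 gA).
    by move=> x y /asboolP ? /asboolP ?; apply/asboolP/AB.
  by move=> x y /asboolP ? /asboolP ?; apply/asboolP/AM.
pose V : subringClosed K := HB.pack_for (subringClosed K) Q
  (GRing.isSubringClosed.Build K Q cQ).
apply: nAu; apply/asboolP; apply: (h V).
  by move=> z; case: (maximal_valring gA maxA z) => ?; [left|right]; apply/asboolP.
by move=> x /AR ?; apply/asboolP.
Qed.

End Chevalley.

(** The direction of Krull's description of the integral closure that produces an equation. The case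
    [u = 0] is separate because the construction adjoins the inverse of [u]. *)
Lemma integral_of_valrings (R : subringClosed K) u :
  (forall V, valring V -> {subset R <= V} -> u \in V) ->
  exists n (r : 'I_n -> K),
    (forall i, r i \in R) /\ u ^+ n = \sum_(i < n) r i * u ^+ i.
Proof.
have [-> _|u0] := eqVneq u 0; last exact: integral_of_valrings0.
exists 1%N, (fun=> 0); split; first by move=> _; exact: rpred0.
by rewrite expr1 big_ord1 mul0r.
Qed.

End ValuationRings.

(** * Regular elements of an affine chart *)

Section ValringIdeal.
Variables (K : fieldType) (V : subringClosed K).
Hypothesis vV : valring V.

(** The maximal ideal of [V]. Zero is listed apart because [0^-1 = 0] lies in [V]. *)
Definition nonunit x := (x \in V) && ((x == 0) || (x^-1 \notin V)).

Lemma nonunit0 : nonunit 0.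
Proof. by rewrite /nonunit rpred0 eqxx. Qed.

Lemma nonunitM v x : v \in V -> nonunit x -> nonunit (v * x).
Proof.
move=> vV' /andP[xV h]; rewrite /nonunit rpredM //=.
have [//|/=] := eqVneq (v * x) 0; rewrite mulf_eq0 negb_or => /andP[v0 x0].
move: h; rewrite (negbTE x0) /=; apply: contra => h.
have -> : x^-1 = v * (v * x)^-1 by field; rewrite v0 x0.
exact: rpredM.
Qed.

Lemma nonunitD x y : nonunit x -> nonunit y -> nonunit (x + y).
Proof.
move=> hx hy.
have [->|x0] := eqVneq x 0; first by rewrite add0r.
have [->|y0] := eqVneq y 0; first by rewrite addr0.
have [h|h] := vV (x / y).
  have -> : x + y = (1 + x / y) * y by field.
  by apply: nonunitM => //; rewrite rpredD ?rpred1.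
have -> : x + y = (1 + (x / y)^-1) * x by field; rewrite x0 y0.
by apply: nonunitM => //; rewrite rpredD ?rpred1.
Qed.

Lemma nonunitN x : nonunit x -> nonunit (- x).
Proof. by move=> h; rewrite -mulN1r; apply: nonunitM => //; rewrite rpredN rpred1. Qed.

End ValringIdeal.

Section PolyDiv.
Variables (L : fieldType) (p : nat).
Hypothesis p_gt1 : (1 < p)%N.

(** Once the gcd is divided out, [m'] is coprime to [B'], so arbitrarily high powers of [m'] divide
    the fixed polynomial [d]; by degrees [m'] is constant. *)
Lemma dvdp_of_frob_dvdp (m d B : {poly L}) : m != 0 -> d != 0 ->
  (forall k, m ^+ (p ^ k) %| d * B ^+ (p ^ k)) -> m %| B.
Proof.
move=> m0 d0 h; set g := gcdp m B.
have g0 : g != 0 by rewrite gcdp_eq0 negb_and m0.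
have /dvdpP[m' em] : g %| m by exact: dvdp_gcdl.
have /dvdpP[B' eB] : g %| B by exact: dvdp_gcdr.
have cop : coprimep m' B'.
  have : coprimep (m %/ g) (B %/ g) by apply: coprimep_div_gcd; rewrite m0.
  by rewrite em eB !mulpK.
have hk k : m' ^+ (p ^ k) %| d.
  have := h k; rewrite em eB !exprMn mulrA dvdp_mul2r ?expf_neq0 //.
  by rewrite Gauss_dvdpl // coprimep_expl // coprimep_expr.
have m'0 : m' != 0 by apply: contraNneq m0 => e; rewrite em e mul0r.
have sm : size m' = 1.
  have := dvdp_leq d0 (hk (size d)).
  have := size_exp m' (p ^ size d); rewrite -size_poly_gt0 in m'0.
  move: (size (m' ^+ _)) => a.
  have := ltn_expl (size d) p_gt1.
  case: (size m') m'0 => [|[|s]] //= _ h1 h2 h3.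
  have : (p ^ size d <= s.+1 * p ^ size d)%N by rewrite leq_pmull.
  by rewrite -h2 => /(leq_trans h1)/leq_trans/(_ (leq_pred a))/leq_trans/(_ h3); rewrite ltnn.
have /size_poly1P[a a0 ea] : size m' == 1 by rewrite sm.
by rewrite em eB ea dvdp_mul2r // -[a%:P]mulr1 mul_polyC dvdpZl // dvd1p.
Qed.

End PolyDiv.

(** * Denominators, poles and derivations on one chart *)

Section Chart.
Variables (L K : fieldType) (ev : {rmorphism {poly L} -> K}).
Variables (p : nat) (chK : p \in [pchar K]).

Hypothesis ev_inj : forall P, ev P = 0 -> P = 0.
Variables (M : divringClosed K).
Hypothesis evM : forall P, ev P \in M.
Hypothesis M_frac : forall a, a \in M -> exists P Q, Q != 0 /\ a * ev Q = ev P.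
Variables (n : nat) (e : 'I_n -> K).
Hypothesis e_span : forall z, z \in span M e.
Hypothesis ep_span : forall z, z \in span M (fun i => e i ^+ p).
Hypothesis eq_indep : forall k, indep M (fun i => e i ^+ (p ^ k)).

Let p_pr : prime p. Proof. by case/andP: chK. Qed.

Lemma ev_eq0 P : (ev P == 0) = (P == 0).
Proof. by apply/eqP/eqP => [/ev_inj//|->]; rewrite rmorph0. Qed.

Lemma common_denom (I : finType) (c : I -> K) : (forall i, c i \in M) ->
  exists (Q : {poly L}) (P : I -> {poly L}), Q != 0 /\ forall i, c i * ev Q = ev (P i).
Proof.
move=> hc.
have /choice[f hf] : forall i, exists PQ : {poly L} * {poly L},
    PQ.2 != 0 /\ c i * ev PQ.2 = ev PQ.1.
  by move=> i; have [P [Q ?]] := M_frac (hc i); exists (P, Q).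
exists (\prod_i (f i).2), (fun i => (f i).1 * \prod_(k | k != i) (f k).2); split.
  by apply/prodf_neq0 => i _; case: (hf i).
by move=> i; rewrite (bigD1 i) //= rmorphM mulrA (hf i).2 -rmorphM.
Qed.

Definition lat (e' : 'I_n -> K) z := exists P : 'I_n -> {poly L}, z = \sum_i ev (P i) * e' i.

Lemma lat_scale e' P z : lat e' z -> lat e' (ev P * z).
Proof.
case=> Q ->; exists (fun i => P * Q i); rewrite mulr_sumr.
by apply: eq_bigr => i _; rewrite rmorphM mulrA.
Qed.

Lemma latD e' y z : lat e' y -> lat e' z -> lat e' (y + z).
Proof.
case=> P -> [Q ->]; exists (fun i => P i + Q i); rewrite -big_split.
by apply: eq_bigr => i _; rewrite rmorphD mulrDl.
Qed.

Lemma lat0 e' : lat e' 0.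
Proof. by exists (fun=> 0); rewrite big1 // => i _; rewrite rmorph0 mul0r. Qed.

Lemma lat_sum e' (I : finType) (F : I -> K) : (forall i, lat e' (F i)) -> lat e' (\sum_i F i).
Proof. by move=> h; apply: big_ind => //; [exact: lat0 | exact: latD]. Qed.

Lemma lat_denom e' z : z \in span M e' -> exists2 d, d != 0 & lat e' (ev d * z).
Proof.
case/spanP=> c hc ->; have [Q [P [Q0 hP]]] := common_denom hc; exists Q => //.
exists P; rewrite mulr_sumr; apply: eq_bigr => i _.
by rewrite mulrA [ev Q * _]mulrC hP.
Qed.

Lemma lat_denoms e' (I : finType) (z : I -> K) : (forall i, z i \in span M e') ->
  exists2 d, d != 0 & forall i, lat e' (ev d * z i).
Proof.
move=> hz; have /choice[d hd] : forall i, exists d, d != 0 /\ lat e' (ev d * z i).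
  by move=> i; have [d] := lat_denom (hz i); exists d.
exists (\prod_i d i); first by apply/prodf_neq0 => i _; case: (hd i).
move=> i; rewrite (bigD1 i) //= rmorphM [ev (d i) * _]mulrC -mulrA.
by apply: lat_scale; case: (hd i).
Qed.

Definition over_chart (V : subringClosed K) :=
  [/\ valring V, forall a, ev a%:P \in V & ev 'X \in V].
(** The integral closure of the image of [ev], in valuative form: functions without poles on the
    chart. Closure under sums and products is then immediate, and [integral_of_valrings] gives
    equations back. *)
Definition regular u := forall V, over_chart V -> u \in V.

Lemma over_ev V P : over_chart V -> ev P \in V.
Proof.
case=> _ h1 h2; elim/poly_ind: P => [|P a IH]; first by rewrite rmorph0 rpred0.
by rewrite rmorphD rmorphM rpredD ?rpredM.
Qed.

Lemma size_map_ev (C : {poly {poly L}}) : (size (map_poly ev C) <= size C)%N.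
Proof.
by apply/leq_sizeP=> i hi; rewrite coef_map /= nth_default // rmorph0.
Qed.

Lemma regular_ev P : regular (ev P). Proof. by move=> V; exact: over_ev. Qed.
Lemma regularD x y : regular x -> regular y -> regular (x + y).
Proof. by move=> hx hy V hV; rewrite rpredD ?hx ?hy. Qed.
Lemma regularB x y : regular x -> regular y -> regular (x - y).
Proof. by move=> hx hy V hV; rewrite rpredB ?hx ?hy. Qed.
Lemma regularM x y : regular x -> regular y -> regular (x * y).
Proof. by move=> hx hy V hV; rewrite rpredM ?hx ?hy. Qed.
Lemma regular_sum (I : finType) (F : I -> K) : (forall i, regular (F i)) -> regular (\sum_i F i).
Proof. by move=> h V hV; apply: rpred_sum => i _; exact: h. Qed.

(** An integral equation expresses every power of [u] through the first [N] ones, with coefficients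
    in the image of [ev]; clearing the denominators of these [N] powers serves for all [k]. *)
Lemma regular_lat u : regular u -> exists2 d, d != 0 & forall k, lat e (ev d * u ^+ k).
Proof.
move=> hu.
pose Q : {pred K} := fun x => `[< exists P, x = ev P >].
have cQ : subring_closed Q.
  split; first by apply/asboolP; exists 1; rewrite rmorph1.
    by move=> _ _ /asboolP[P ->] /asboolP[P' ->]; apply/asboolP; exists (P - P'); rewrite rmorphB.
  by move=> _ _ /asboolP[P ->] /asboolP[P' ->]; apply/asboolP; exists (P * P'); rewrite rmorphM.
pose R : subringClosed K := HB.pack_for (subringClosed K) Q
  (GRing.isSubringClosed.Build K Q cQ).
have [V vV hV|N [r [hr eN]]] := @integral_of_valrings K R u.
  apply: hu; split=> //; [move=> a|]; apply: hV; apply/asboolP.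
    by exists a%:P.
  by exists 'X.
have [d d0 hd] := @lat_denoms e 'I_N (fun i => u ^+ i) (fun i => e_span _).
exists d => // k; elim/ltn_ind: k => k IH.
have [ltk|lek] := ltnP k N; first exact: (hd (Ordinal ltk)).
rewrite -(subnK lek) exprD eN !mulr_sumr; apply: lat_sum => i.
have /asboolP[P ->] := hr i.
have -> : ev d * (u ^+ (k - N) * (ev P * u ^+ i)) = ev P * (ev d * u ^+ (k - N + i)).
  by rewrite exprD; ring.
apply: lat_scale; apply: IH; have := ltn_ord i; lia.
Qed.

(** Passing from [k] to [k + 1] raises the denominator [c ^+ a] to the power p and adds one factor
    [c]. The recursion a -> p a + 1 from 0 does not exceed p^k - 1, because p is at least 2; so the
    denominators grow no faster than the p^k-th powers of one fixed element. *)
Lemma frob_lat : exists2 c, c != 0 & forall k i,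
  lat (fun i => e i ^+ (p ^ k)) (ev c ^+ (p ^ k).-1 * e i).
Proof.
have [c c0 hc] := @lat_denoms (fun i => e i ^+ p) 'I_n e (fun i => ep_span _).
exists c => //; elim=> [|k IH] i.
  rewrite expn0 expr0 mul1r; exists (fun k => (k == i)%:R).
  rewrite (bigD1 i) //= eqxx rmorph1 mul1r expr1 big1 ?addr0 // => m /negbTE->.
  by rewrite rmorph0 mul0r.
have [C eC] := hc i.
have hq m : lat (fun i => e i ^+ (p ^ k.+1)) (ev c ^+ ((p ^ k).-1 * p) * e m ^+ p).
  have [B eB] := IH m; exists (fun i => B i ^+ p).
  rewrite exprM -exprMn eB (frob_sum chK); apply: eq_bigr => q _.
  by rewrite exprMn rmorphXn -exprM -expnSr.
have p2 := prime_gt1 p_pr.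
have pk : (0 < p ^ k)%N by rewrite expn_gt0 prime_gt0.
have le : (((p ^ k).-1 * p).+1 <= (p ^ k.+1).-1)%N.
  rewrite expnS; case: (p ^ k)%N pk => // a _ /=; nia.
rewrite -(subnK le) exprD exprSr -!mulrA eC -rmorphXn; apply: lat_scale.
rewrite mulr_sumr; apply: lat_sum => m; rewrite mulrCA; apply: lat_scale; exact: hq.
Qed.

(* [d * u ^+ q] lies in the lattice for every power [q] of [p], with [d] fixed;
   in the basis [e i ^+ q] this bounds [q] times the denominators of [c * u] by
   those of [d], so [c * u] has none. *)
Lemma conductor : exists2 c, c != 0 & forall u, regular u -> lat e (ev c * u).
Proof.
have [c c0 hc] := frob_lat; exists c => // u /regular_lat[d d0 hd].
have [m m0 [A eA]] := lat_denom (e_span u).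
suff h i : m %| c * A i.
  have /choice[A' hA'] : forall i, exists B, c * A i = B * m.
    by move=> i; have /dvdpP[B] := h i; exists B.
  exists A'; have ev0 : ev m != 0 by rewrite ev_eq0.
  apply: (mulfI ev0); rewrite mulrCA eA !mulr_sumr; apply: eq_bigr => k _.
  by have := congr1 ev (hA' k); rewrite !rmorphM mulrA => ->; ring.
apply: (@dvdp_of_frob_dvdp L p (prime_gt1 p_pr) m d) => // k.
have [B eB] : lat (fun i => e i ^+ (p ^ k)) (ev d * ev c ^+ (p ^ k) * u ^+ (p ^ k)).
  have [T eT] := hd (p ^ k)%N.
  rewrite mulrAC eT mulr_suml; apply: lat_sum => l.
  have pk : (0 < p ^ k)%N by rewrite expn_gt0 prime_gt0.
  rewrite -mulrA; apply: lat_scale; rewrite -(prednK pk) exprSr mulrC -mulrA mulrCA.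
  by apply: lat_scale; rewrite prednK.
have eAk : ev m ^+ (p ^ k) * u ^+ (p ^ k) = \sum_i ev (A i ^+ (p ^ k)) * e i ^+ (p ^ k).
  rewrite -exprMn eA; elim: (k) => [|l IH]; first by apply: eq_bigr => q _; rewrite !expr1.
  rewrite expnSr exprM IH (frob_sum chK); apply: eq_bigr => q _.
  by rewrite exprMn -rmorphXn -!exprM.
have := @eq_indep k (fun i => ev (m ^+ (p ^ k) * B i - d * c ^+ (p ^ k) * A i ^+ (p ^ k))).
move/(_ (fun i => evM _)) => h0.
have /h0/(_ i)/ev_inj/eqP :
  \sum_i ev (m ^+ (p ^ k) * B i - d * c ^+ (p ^ k) * A i ^+ (p ^ k)) * e i ^+ (p ^ k) = 0.
  transitivity (ev m ^+ (p ^ k) * (\sum_i ev (B i) * e i ^+ (p ^ k)) -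
     ev d * ev c ^+ (p ^ k) * (\sum_i ev (A i ^+ (p ^ k)) * e i ^+ (p ^ k))).
    rewrite !mulr_sumr -sumrB; apply: eq_bigr => l _.
    rewrite rmorphB !rmorphM mulrBl !mulrA; congr (_ * _ * _ - _ * _ * _ * _); exact: rmorphXn.
  by rewrite -eB -eAk; ring.
rewrite subr_eq0 => /eqP e'; apply/dvdpP; exists (B i).
by rewrite exprMn mulrA -e' mulrC.
Qed.

Lemma alg_relation z : exists2 C : {poly {poly L}}, C != 0 & (map_poly ev C).[z] = 0.
Proof.
have [|i|c [hc [i0 hi0] h0]] := @steinitz K M 'I_n 'I_n.+1 e (fun i => z ^+ i).
- by rewrite !card_ord.
- exact: e_span.
have [Q [P [Q0 hP]]] := common_denom hc.
pose C := \poly_(i < n.+1) P (inord i).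
have eC (i : 'I_n.+1) : C`_i = P i by rewrite coef_poly ltn_ord inord_val.
exists C.
  apply: contraNneq hi0 => e0; have := hP i0; rewrite -eC e0 coef0 rmorph0 => /eqP.
  by rewrite mulf_eq0 ev_eq0 (negbTE Q0) orbF.
rewrite (@horner_coef_wide _ n.+1); last by rewrite (leq_trans (size_map_ev _)) ?size_poly.
transitivity (ev Q * \sum_(i < n.+1) c i * z ^+ i); last by rewrite h0 mulr0.
by rewrite mulr_sumr; apply: eq_bigr => i _; rewrite coef_map /= eC -hP mulrCA mulrA.
Qed.

Section Relation.
(* For a relation [\sum_k c_k z^k = 0] put [b i = \sum_(k >= i) c_k z^(k-i)]; both
   [b i] and [z * b i.+1] are regular, by cases on whether [z] or [z^-1] is in V. *)
Variables (C : {poly {poly L}}) (z : K).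
Hypothesis Cz : (map_poly ev C).[z] = 0.

Let b i := (map_poly ev (drop_poly i C)).[z].

Lemma relation_rec i : b i = ev C`_i + z * b i.+1.
Proof.
rewrite /b (_ : drop_poly i C = (C`_i)%:P + drop_poly i.+1 C * 'X); last first.
  apply/polyP=> k; rewrite coefD coefC coefMX !coef_drop_poly.
  by case: k => [|k] /=; rewrite ?addr0 ?add0r // addSnnS.
by rewrite rmorphD rmorphM /= map_polyC map_polyX !hornerE [z * _]mulrC.
Qed.

Lemma relation0 : b 0 = 0. Proof. by rewrite /b drop_poly0l. Qed.

Lemma relation_regular i : regular (b i).
Proof.
move=> V oV; have [vV jV tV] := oV.
have over_horner (P : {poly {poly L}}) y : y \in V -> (map_poly ev P).[y] \in V.
  move=> yV; apply: rpred_horner => //; apply/polyOverP=> k.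
  by rewrite coef_map; exact: over_ev.
case: (vV z) => zV; first exact: over_horner.
have [z0|z0] := eqVneq z 0; first by apply: over_horner; rewrite z0 rpred0.
have -> : b i = - \sum_(k < i) ev C`_k * z^-1 ^+ (i - k).
  have /eqP := Cz; rewrite -{1}(poly_take_drop i C) rmorphD rmorphM /= map_polyXn.
  rewrite hornerD hornerM hornerXn addrC addr_eq0 => /eqP h.
  apply: (mulIf (expf_neq0 i z0)); rewrite [LHS]h mulNr; congr (- _).
  rewrite (@horner_coef_wide _ i); last first.
    by rewrite (leq_trans (size_map_ev _)) ?size_take_poly.
  rewrite mulr_suml; apply: eq_bigr => k _; rewrite coef_map coef_take_poly ltn_ord.
  have le : (k <= i)%N by rewrite ltnW.
  rewrite -mulrA; congr (_ * _).
  have -> : z ^+ i = z ^+ (i - k) * z ^+ k by rewrite -exprD subnK.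
  by rewrite mulrA -exprMn mulVf // expr1n mul1r.
by rewrite rpredN; apply: rpred_sum => k _; rewrite rpredM ?rpredX ?over_ev.
Qed.

Lemma relation_mul_regular i : regular (z * b i.+1).
Proof.
have -> : z * b i.+1 = b i - ev C`_i by rewrite (relation_rec i) addrAC subrr add0r.
by apply: regularB; [exact: relation_regular | exact: regular_ev].
Qed.

End Relation.

(** The last non-zero tail of a relation is its leading coefficient, which [relation_mul_regular]
    turns into a denominator for [z]. *)
Lemma regular_denom z : exists2 h, h != 0 & regular (ev h * z).
Proof.
have [C C0 Cz] := alg_relation z.
case sC: (size C) => [|[|N]].
- by move/eqP: sC; rewrite size_poly_eq0 (negbTE C0).
- have /size_poly1P[a a0 eC] : size C == 1 by rewrite sC.
  by move: Cz a0; rewrite eC map_polyC hornerC => /ev_inj->; rewrite eqxx.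
exists (lead_coef C); first by rewrite lead_coef_eq0.
have := relation_mul_regular Cz N; rewrite mulrC.
have -> : drop_poly N.+1 C = (lead_coef C)%:P; last by rewrite map_polyC hornerC.
apply/polyP=> k; rewrite coef_drop_poly coefC lead_coefE sC.
by case: k => //= k; rewrite nth_default // sC addSn ltnS leq_addl.
Qed.

(* Divide a relation by the generator of the ideal of V in L[t] as long as all
   its coefficients lie in that ideal. *)
Lemma primitive_relation V z : over_chart V ->
  exists (C : {poly {poly L}}) i, (map_poly ev C).[z] = 0 /\ ~~ nonunit V (ev C`_i).
Proof.
move=> oV; have [vV jV tV] := oV.
have [C C0 Cz] := alg_relation z.
have Ci0 : C`_(size C).-1 != 0 by rewrite -lead_coefE lead_coef_eq0.
move: (size C).-1 Ci0 => i0 Ci0 {C0}.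
have [N] := ubnP (size C`_i0); elim: N C Cz Ci0 => // N IH C Cz Ci0 leN.
have [[i hi]|no] := pselect (exists i, ~~ nonunit V (ev C`_i)); first by exists C, i.
have allC i : nonunit V (ev C`_i) by apply: contrapT => h; apply: no; exists i; apply/negP.
pose Q m := `[< exists P : {poly L}, [/\ P != 0, nonunit V (ev P) & size P = m] >].
have exQ : exists m, Q m by exists (size C`_i0); apply/asboolP; exists C`_i0.
case: (ex_minnP exQ) => m /asboolP[q [q0 hq sq]] minm.
have dvd P : nonunit V (ev P) -> q %| P.
  move=> hP; apply/modp_eq0P/eqP/negPn/negP => r0.
  have /minm : Q (size (P %% q)).
    apply/asboolP; exists (P %% q); split=> //.
    have -> : P %% q = P - P %/ q * q by rewrite {2}(divp_eq P q) addrC addKr.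
    rewrite rmorphB rmorphM; apply: (nonunitD vV) => //; apply: nonunitN.
    by apply: nonunitM => //; exact: over_ev.
  by rewrite leqNgt -sq ltn_modp q0.
have sq1 : (1 < size q)%N.
  rewrite ltnNge; apply/negP => /size1_polyC eq.
  move: hq q0; rewrite eq polyC_eq0; move: (q`_0) => a /andP[_ /orP[|]].
    by rewrite ev_eq0 polyC_eq0 => ->.
  move=> h a0; case/negP: h; have := jV a^-1.
  suff -> : ev a^-1%:P = (ev a%:P)^-1 by [].
  have ea0 : ev a%:P != 0 by rewrite ev_eq0 polyC_eq0.
  by apply: (mulIf ea0); rewrite mulVf // -rmorphM -polyCM mulVf // rmorph1.
pose C' := \poly_(i < size C) (C`_i %/ q).
have eC i : C`_i = C'`_i * q.
  rewrite coef_poly; case: ltnP => hi; last by rewrite mul0r nth_default.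
  by rewrite divpK // dvd.
have C'i0 : C'`_i0 != 0 by apply: contraNneq Ci0 => h; rewrite eC h mul0r.
apply: (IH C') => //.
  have : ev q != 0 by rewrite ev_eq0.
  move/mulIf; apply; rewrite mul0r -[RHS]Cz (@horner_coef_wide _ (size C)); last first.
    by rewrite (leq_trans (size_map_ev _)) ?size_poly.
  rewrite [RHS](@horner_coef_wide _ (size C)); last by rewrite (leq_trans (size_map_ev _)).
  rewrite mulr_suml; apply: eq_bigr => i _.
  by rewrite !coef_map /= eC rmorphM mulrAC.
have : (size (C'`_i0)%R < size (C`_i0)%R)%N.
  rewrite (eC i0) size_mul //; have : (0 < size (C'`_i0)%R)%N by rewrite size_poly_gt0.
  by case: (size q) sq1 => [|[|k]] // _; rewrite addnS /= addnS ltnS leq_addr.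
by move/leq_trans; apply.
Qed.

(** If some tail [b k.+1] is a unit of [V], it is the denominator sought, with numerator
    [z * b k.+1]. If none is, [relation_rec] puts every coefficient of the relation into the maximal
    ideal, against [primitive_relation]. *)
Lemma local_fraction V z : over_chart V -> z \in V ->
  exists a s, [/\ regular a, regular s, s != 0, s^-1 \in V & z * s = a].
Proof.
move=> oV zV; have [vV jV tV] := oV.
have [C [i [Cz hi]]] := primitive_relation z oV.
pose b i := (map_poly ev (drop_poly i C)).[z].
have [[k hk]|no] := pselect (exists k, ~~ nonunit V (b k.+1)).
  exists (z * b k.+1), (b k.+1).
  have bV : b k.+1 \in V by apply: relation_regular.
  move: hk; rewrite /nonunit bV /= negb_or negbK => /andP[b0 bi].
  by split=> //; [exact: relation_mul_regular | exact: relation_regular].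
have all k : nonunit V (b k).
  case: k => [|k]; first by rewrite [b 0%N]relation0 ?nonunit0.
  by apply: contrapT => h; apply: no; exists k; apply/negP.
case/negP: hi; have -> : ev C`_i = b i - z * b i.+1.
  by have := relation_rec C z i; rewrite -/(b i) -/(b i.+1) => ->; rewrite addrK.
by apply: (nonunitD vV) => //; apply: nonunitN; apply: nonunitM.
Qed.

Variable D : K -> K.
Hypotheses (dD : derivation D) (Dj : forall a, D (ev a%:P) = 0).
Variable T : {poly L}.
Hypothesis Dt : D (ev 'X) = ev T.

Lemma der_ev P : D (ev P) = ev (P^`() * T).
Proof.
elim/poly_ind: P => [|P a IH]; first by rewrite deriv0 mul0r rmorph0 (der0 dD).
rewrite rmorphD rmorphM (derD dD) (derM dD) Dj addr0 IH Dt derivD derivM derivX derivC.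
by rewrite mulr1 addr0 mulrDl rmorphD !rmorphM; ring.
Qed.

(** By [conductor] a fixed multiple of any regular element has polynomial coordinates in the basis
    [e], and [D] keeps polynomials polynomial. Only the poles of the finitely many [e i] and
    [D (e i)] remain, and [H] clears them. *)
Lemma der_regular : exists2 d, d != 0 & forall a, regular a -> regular (ev d * D a).
Proof.
have [c c0 hc] := conductor.
have /choice[h hh] : forall x, exists h, h != 0 /\ regular (ev h * x).
  by move=> x; have [h ? ?] := regular_denom x; exists h.
pose H := \prod_i (h (e i) * h (D (e i))).
have H0 : H != 0.
  by apply/prodf_neq0 => i _; rewrite mulf_neq0 //; case: (hh (e i)); case: (hh (D (e i))).
have He i : regular (ev H * e i).
  rewrite /H (bigD1 i) //=; move: (\prod_(_ | _) _) => R.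
  have -> : ev (h (e i) * h (D (e i)) * R) * e i =
      (ev (h (e i)) * e i) * ev (h (D (e i)) * R) by rewrite !rmorphM; ring.
  by apply: regularM; [case: (hh (e i)) | exact: regular_ev].
have HDe i : regular (ev H * D (e i)).
  rewrite /H (bigD1 i) //=; move: (\prod_(_ | _) _) => R.
  have -> : ev (h (e i) * h (D (e i)) * R) * D (e i) =
      (ev (h (D (e i))) * D (e i)) * ev (h (e i) * R) by rewrite !rmorphM; ring.
  by apply: regularM; [case: (hh (D (e i))) | exact: regular_ev].
exists (H * c) => [|a ra]; first exact: mulf_neq0.
have [P eP] := hc a ra.
have -> : ev (H * c) * D a =
  (\sum_i (ev ((P i)^`() * T) * (ev H * e i) + ev (P i) * (ev H * D (e i))))
    - ev (c^`() * T * H) * a.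
  rewrite -[LHS](addrK (ev (c^`() * T * H) * a)); congr (_ - _).
  transitivity (ev H * D (ev c * a)).
    by rewrite (derM dD) der_ev !rmorphM; ring.
  rewrite eP (der_sum dD) mulr_sumr; apply: eq_bigr => i _.
  by rewrite (derM dD) der_ev; ring.
apply: regularB; last by apply: regularM => //; exact: regular_ev.
apply: regular_sum => i; apply: regularD; apply: regularM => //; exact: regular_ev.
Qed.

(** The quotient rule on the fraction of [local_fraction], whose denominator is a unit of [V],
    creates no new pole; hence one [d] serves all [V] and [z]. *)
Lemma der_valring : exists2 d, d != 0 & forall V z, over_chart V -> z \in V -> ev d * D z \in V.
Proof.
have [d d0 hd] := der_regular; exists d => // V z oV zV.
have [a [s [ra rs s0 sV ez]]] := local_fraction oV zV.
have -> : ev d * D z = (ev d * D a - z * (ev d * D s)) * s^-1.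
  by apply: (mulIf s0); rewrite mulfVK // -ez (derM dD); ring.
apply: rpredM => //; apply: rpredB; first exact: hd.
by apply: rpredM => //; exact: hd.
Qed.

End Chart.

(** * Finiteness over the field generated by a p-basis *)

Section Finite.
Variable K : fieldType.
Implicit Types S : divringClosed K.

Definition transc S x := forall P : {poly K}, P \is a polyOver S -> P.[x] = 0 -> P = 0.

Lemma gen1_frac S a x : x \in gen S [:: a] -> exists P Q : {poly K},
  [/\ P \is a polyOver S, Q \is a polyOver S, Q.[a] != 0 & x = P.[a] / Q.[a]].
Proof.
move: x; apply: gen_ind.
- by exists 1, 1; rewrite !rpred1 !hornerC oner_neq0 divr1.
- move=> _ _ [P [Q [hP hQ Q0 ->]]] [P' [Q' [hP' hQ' Q'0 ->]]].
  exists (P * Q' - P' * Q), (Q * Q'); rewrite rpredB ?rpredM // !hornerE mulf_neq0 //; split=> //.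
  by field; rewrite Q0 Q'0.
- move=> _ _ [P [Q [hP hQ Q0 ->]]] [P' [Q' [hP' hQ' Q'0 ->]]].
  have [P'0|P'0] := eqVneq P'.[a] 0.
    by exists 0, 1; rewrite rpred0 rpred1 hornerC oner_neq0 horner0 P'0 !mul0r invr0 mulr0.
  exists (P * Q'), (Q * P'); rewrite !rpredM // !hornerE mulf_neq0 //; split=> //.
  by field; rewrite P'0 Q0 Q'0.
- by move=> c hc; exists c%:P, 1; rewrite polyOverC hc rpred1 !hornerC oner_neq0 divr1.
- move=> c; rewrite inE => /eqP->; exists 'X, 1.
  by rewrite polyOverX rpred1 hornerX hornerC oner_neq0 divr1.
Qed.

Lemma inv_algebraic S (R : {poly K}) y : R \is a polyOver S -> R != 0 -> R.[y] = 0 ->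
  y != 0 -> exists2 Q : {poly K}, Q \is a polyOver S & y^-1 = Q.[y].
Proof.
have [N] := ubnP (size R); elim: N R => // N IH R leN hR R0 Ry y0.
have eR : R = (R`_0)%:P + drop_poly 1 R * 'X.
  apply/polyP=> k; rewrite coefD coefC coefMX coef_drop_poly.
  by case: k => [|k] /=; rewrite ?addr0 ?add0r // addn1.
have hd : drop_poly 1 R \is a polyOver S.
  by apply/polyOverP=> i; rewrite coef_drop_poly (polyOverP hR).
have e0 : R`_0 + (drop_poly 1 R).[y] * y = 0 by have := Ry; rewrite {1}eR !hornerE.
have [R00|R00] := eqVneq R`_0 0; last first.
  exists (- (R`_0)^-1%:P * drop_poly 1 R).
    by rewrite rpredM ?rpredN ?polyOverC ?rpredV ?(polyOverP hR).
  move/eqP: e0; rewrite addrC addr_eq0 => /eqP e0; apply: (mulIf y0).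
  by rewrite mulVf // !hornerE -mulrA e0 mulrNN mulVf.
apply: (IH (drop_poly 1 R)) => //.
- rewrite size_drop_poly subn1; have : (0 < size R)%N by rewrite size_poly_gt0.
  by case: (size R) leN => // k; rewrite ltnS.
- by apply: contraNneq R0 => e; rewrite eR R00 e mul0r addr0.
- by move/eqP: e0; rewrite R00 add0r mulf_eq0 (negbTE y0) orbF => /eqP.
Qed.

Lemma gen1_algebraic S (P : {poly K}) a : P \is a polyOver S -> P != 0 -> P.[a] = 0 ->
  {subset gen S [:: a] <= span S (fun i : 'I_(size P).-1 => a ^+ i)}.
Proof.
move=> hP P0 Pa; set e := fun i : 'I__ => _.
have hspan (Q : {poly K}) : Q \is a polyOver S -> Q.[a] \in span S e.
  move=> /polyOverP hQ; rewrite horner_coef; apply: rpred_sum => i _.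
  by apply: span_scale => //; exact: powers_span.
suff hx x : x \in gen S [:: a] -> exists2 Q : {poly K}, Q \is a polyOver S & x = Q.[a].
  by move=> x /hx[Q hQ ->]; exact: hspan.
move: x; apply: gen_ind.
- by exists 1; rewrite ?rpred1 ?hornerC.
- by move=> _ _ [Q hQ ->] [Q' hQ' ->]; exists (Q - Q'); rewrite ?rpredB // !hornerE.
- move=> _ _ [Q hQ ->] [Q' hQ' ->].
  have [->|y0] := eqVneq Q'.[a] 0; first by exists 0; rewrite ?rpred0 // invr0 mulr0 horner0.
  have [|j|c [hc [i0 ci0] c0]] := @steinitz K S _ 'I_(size P).-1.+1 e (fun i => Q'.[a] ^+ i).
  + by rewrite !card_ord.
  + by rewrite -horner_exp; apply: hspan; rewrite rpredX.
  have [|||R hR eR] := @inv_algebraic S (\poly_(i < (size P).-1.+1) c (inord i)) Q'.[a] _ _ _ y0.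
  + apply/polyOverP=> i; rewrite coef_poly; case: ifP => // _; exact: rpred0.
  + apply: contraNneq ci0 => /polyP/(_ i0); rewrite coef_poly ltn_ord inord_val coef0 => ->.
    by [].
  + rewrite (@horner_coef_wide _ (size P).-1.+1) ?size_poly // -[RHS]c0.
    by apply: eq_bigr => i _; rewrite coef_poly ltn_ord inord_val.
  exists (Q * (R \Po Q')); first by rewrite rpredM // polyOver_comp.
  by rewrite hornerM horner_comp -eR.
- by move=> c hc; exists c%:P; rewrite ?polyOverC ?hornerC.
- by move=> c; rewrite inE => /eqP->; exists 'X; rewrite ?polyOverX ?hornerX.
Qed.

(** The generators are adjoined one by one; unless every step is algebraic, [t] is the last
    generator that is transcendental over the field generated before it. *)
Lemma finite_or_transc S l : (forall z, z \in gen S l) -> finite_over S \/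
  exists (G : divringClosed K) t, [/\ {subset S <= G}, transc G t & finite_over (gen G [:: t])].
Proof.
elim: l S => [|a l IH] S hS.
  left; exists 1%N, (fun=> 1) => z; apply/spanP; exists (fun=> z).
    by move=> _; apply: gen_min (hS z).
  by rewrite big_ord1 mulr1.
have [|f|[G [t [h1 h2 h3]]]] := IH (gen S [:: a]).
- move=> z; apply: (gen_subset _ _ (hS z)) => x hx; first by apply/gen_sub/gen_sub.
  move: hx; rewrite inE => /predU1P[->|xl]; last exact: gen_mem.
  by apply/gen_sub/gen_mem; rewrite mem_head.
- have [tr|ntr] := pselect (transc S a); first by right; exists S, a; split.
  left; have [P [hP Pa P0]] : exists P : {poly K}, [/\ P \is a polyOver S, P.[a] = 0 & P != 0].
    apply: contrapT => no; apply: ntr => P hP Pa; apply/eqP/negPn/negP => P0.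
    by apply: no; exists P.
  exact: finite_tower (gen1_algebraic hP P0 Pa) f.
- right; exists G, t; split=> // x xS; apply: h1; exact: gen_sub.
Qed.

Variables (p : nat) (chK : p \in [pchar K]).
Let p_pr : prime p. Proof. by case/andP: chK. Qed.

(** If t = P(t^p) / Q(t^p), then X Q(X^p) - P(X^p) vanishes at [t], hence is zero. Exponents
    congruent to 1 modulo p occur in its first term only, so [Q] would be zero. *)
Lemma transc_notin_frob (G : divringClosed K) t : transc G t -> t \notin gen G [:: t ^+ p].
Proof.
move=> tr; apply/negP => /gen1_frac[P [Q [hP hQ Q0 et]]].
pose R := 'X * (Q \Po 'X^p) - (P \Po 'X^p).
have R0 : R = 0.
  apply: tr.
    by rewrite rpredB ?rpredM ?polyOver_comp ?polyOverX ?polyOverXn.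
  by rewrite !hornerE !horner_comp !hornerXn {1}et divfK // subrr.
case/negP: Q0; suff -> : Q = 0 by rewrite horner0.
apply/polyP=> i; rewrite coef0.
have /polyP/(_ (p * i).+1) := R0; rewrite coef0 coefB coefXM /= !coef_comp_poly_Xn ?prime_gt0 //.
rewrite dvdn_mulr // mulKn ?prime_gt0 // -addn1 dvdn_addr ?dvdn_mulr // dvdn1.
by rewrite gtn_eqF ?prime_gt1 // subr0.
Qed.

(* A basis of K over G(t) would have its p-th powers spanning K over G(t^p), which
   is smaller than G(t) by a factor p. *)
Lemma not_finite_over_transc (I : seq K) (G : divringClosed K) t :
  (forall z, z \in gen (Kp chK) I) -> {subset I <= G} -> transc G t ->
  ~ finite_over (gen G [:: t]).
Proof.
move=> genI IG tr /finite_basis[N [e [he ie]]].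
set F := gen G [:: t] in he ie; pose H := gen G [:: t ^+ p].
have HF : {subset H <= F}.
  apply: gen_subset => x; first exact: gen_sub.
  by rewrite inE => /eqP->; rewrite rpredX // gen_mem ?mem_head.
have Fp x : x \in F -> x ^+ p \in H.
  move: x; apply: gen_ind; first by rewrite expr1n rpred1.
  - by move=> x y hx hy; rewrite frobB // rpredB.
  - by move=> x y hx hy; rewrite expr_div_n rpred_div.
  - by move=> x xG; rewrite rpredX // gen_sub.
  - by move=> x; rewrite inE => /eqP->; rewrite gen_mem ?mem_head.
pose Z := span H (fun i => e i ^+ p).
have pZ x : x ^+ p \in Z.
  case/spanP: (he x) => a ha ->; rewrite (frob_sum chK); apply/spanP.
  by exists (fun i => a i ^+ p) => [i|]; [exact: Fp | apply: eq_bigr => i _; rewrite exprMn].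
have ZM x y : x \in Z -> y \in Z -> x * y \in Z.
  move=> /spanP[a ha ->] /spanP[c hc ->]; rewrite mulr_suml; apply: rpred_sum => i _.
  rewrite mulr_sumr; apply: rpred_sum => k _.
  have -> : a i * e i ^+ p * (c k * e k ^+ p) = (a i * c k) * (e i * e k) ^+ p.
    by rewrite exprMn; ring.
  by apply: span_scale => //; rewrite rpredM.
have ZX x n : x \in Z -> x ^+ n \in Z.
  move=> xZ; elim: n => [|n IH]; last by rewrite exprS ZM.
  by rewrite expr0 -(expr1n _ p) pZ.
have Zall z : z \in Z.
  move: (genI z); move: z; apply: gen_ind.
  - by rewrite -(expr1n _ p) pZ.
  - by move=> x y hx hy; exact: rpredB.
  - move=> x y hx hy.
    have [->|y0] := eqVneq y 0; first by rewrite invr0 mulr0 rpred0.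
    have -> : x / y = x * y ^+ p.-1 * (y^-1) ^+ p.
      rewrite -mulrA; congr (_ * _); rewrite -[in X in _ * X](prednK (prime_gt0 p_pr)) exprS.
      by rewrite mulrCA exprVn mulfV ?mulr1 // expf_neq0.
    by apply: (ZM); [apply: (ZM) => //; exact: ZX | exact: pZ].
  - by move=> _ /(KpP chK)[x ->].
  - move=> x xI; rewrite -[x]mulr1 -(expr1n _ p); apply: span_scale; last exact: pZ.
    by apply/gen_sub/IG.
case: N e he ie @Z pZ ZM ZX Zall => [|N] e he ie Z pZ ZM ZX Zall.
  case/spanP: (he 1) => a _; rewrite big_ord0 => /eqP; by rewrite oner_eq0.
have [||c [hc [i0 hi0] c0]] := @steinitz K H 'I_N.+1 (option 'I_N.+1) (fun i => e i ^+ p)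
   (fun i => if i is Some k then e k else t * e ord0).
- by rewrite card_option.
- by move=> i; exact: Zall.
have tF : t \in F by rewrite gen_mem ?mem_head.
pose d i := c (Some i) + (if i == ord0 then c None * t else 0).
have hd i : d i \in F.
  apply: rpredD; first exact: HF.
  by case: ifP => _; [apply: rpredM => //; exact: HF | exact: rpred0].
have d0 i : d i = 0.
  apply: (ie d hd); rewrite -[RHS]c0 sum_option addrC (bigD1 ord0) //= [in RHS](bigD1 ord0) //=.
  rewrite /d eqxx mulrDl -!addrA [_ + c None * _]addrC -mulrA; congr (_ + _).
  by congr (_ + _); apply: eq_bigr => k /negbTE->; rewrite addr0.
have cN : c None != 0.
  apply: contraTneq hi0 => cN; rewrite negbK; case: i0 => [i|]; last by rewrite cN.
  by have := d0 i; rewrite /d cN mul0r if_same addr0 => ->.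
case/negP: (transc_notin_frob tr); rewrite -/H.
suff -> : t = - c (Some ord0) / c None by rewrite rpred_div ?rpredN.
have := d0 ord0; rewrite /d eqxx => /eqP; rewrite addrC addr_eq0 => /eqP <-.
by rewrite mulrC mulKf.
Qed.

(** A transcendental generator left over would lie over a field containing the p-basis, which
    [not_finite_over_transc] excludes. *)
Lemma finite_over_pbasis (C0 : divringClosed K) (s I : seq K) :
  (forall z, z \in gen C0 s) -> (forall z, z \in gen (Kp chK) I) ->
  finite_over (gen C0 I).
Proof.
move=> hs hI; have [|//|[G [t [h1 h2 h3]]]] := @finite_or_transc (gen C0 I) s.
  move=> z; apply: (gen_subset _ (@gen_mem _ _ _) (hs z)) => x xC.
  by apply/gen_sub/gen_sub.
case: (not_finite_over_transc hI _ h2 h3) => x xI.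
by apply/h1/gen_mem.
Qed.

End Finite.

(** * The polynomial detecting p-th powers *)

Lemma pred_mul3 p : (0 < p)%N -> (3 * p).-1 = (2 * p + p.-1)%N.
Proof. by lia. Qed.

Lemma gt1_of_degree_le p r r' m : (0 < p)%N -> (1 < r)%N ->
  (r * (3 * p) + m + 2 <= r' * p)%N -> (1 < r')%N.
Proof. by case: r' => [|[|k]] //; nia. Qed.

Lemma size_cancel_le a b c d k m : (0 < a)%N -> (0 < b)%N -> (c <= k.+1)%N ->
  (k + b + a).-1 = (m + d + c).-1 -> (a <= m + d)%N.
Proof. by lia. Qed.

(** * The pole estimate at one valuation ring *)

Section Estimate.
Variables (K : fieldType) (p : nat) (chK : p \in [pchar K]).
Variables (D : K -> K) (V : subringClosed K) (d : K).
Hypotheses (dD : derivation D) (vV : valring V) (hV : forall z, z \in V -> d * D z \in V).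

Let p_gt0 : (0 < p)%N. Proof. by apply: prime_gt0; case/andP: chK. Qed.

Lemma unit_one_plus y : nonunit V y -> (1 + y)^-1 \in V.
Proof.
move=> hy; have yV : y \in V by case/andP: hy.
have : ~~ nonunit V (1 + y).
  apply/negP => /(nonunitD vV)/(_ (nonunitN hy)); rewrite addrK.
  by rewrite /nonunit oner_eq0 invr1 rpred1.
by rewrite /nonunit rpredD ?rpred1 //= negb_or negbK => /andP[].
Qed.

(** At a pole of [x] the term [x ^+ r] dominates: the remaining factor [1 + y] is a unit because
    [y = x^-1 ^+ r.-1] lies in the maximal ideal. *)
Lemma pole_add_exp x r : x \notin V -> (1 < r)%N ->
  exists u u', [/\ u \in V, u' \in V, (x + x ^+ r)^-1 = x^-1 ^+ r * u & x + x ^+ r = x ^+ r * u'].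
Proof.
move=> xV r1; have x0 : x != 0 by apply: contraNneq xV => ->; rewrite rpred0.
have iV : x^-1 \in V by case: (vV x) => //; rewrite (negbTE xV).
pose y := x^-1 ^+ r.-1.
have hy : nonunit V y.
  rewrite /nonunit rpredX // expf_eq0 invr_eq0 (negbTE x0) andbF /=.
  apply: contra xV; rewrite /y exprVn invrK => h.
  have -> : x = x ^+ r.-1 * x^-1 ^+ r.-2.
    case: (r) r1 => [|[|k]] //= _.
    by rewrite exprS -mulrA -exprMn mulfV // expr1n mulr1.
  by apply: rpredM => //; exact: rpredX.
have e : x + x ^+ r = x ^+ r * (1 + y).
  rewrite mulrDr mulr1 addrC; congr (_ + _); rewrite /y.
  by case: (r) r1 => [|k] //= _; rewrite exprS -mulrA -exprMn mulfV // expr1n mulr1.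
exists (1 + y)^-1, (1 + y); split=> //.
- exact: unit_one_plus.
- by rewrite rpredD ?rpred1 //; case/andP: hy.
- by rewrite e invfM exprVn.
Qed.

Lemma der_add_exp x r : (p %| r)%N -> D (x + x ^+ r) = D x.
Proof.
move=> pr; rewrite (derD dD) (derX dD) -mulr_natr.
by move: pr; rewrite (dvdn_pcharf chK) => /eqP->; rewrite mulr0 addr0.
Qed.

Variables (r r' m i : nat) (x w : K).
Let xi := x + x ^+ r.
Let eta := w + w ^+ r'.
Hypotheses (pr : (p %| r)%N) (pr' : (p %| r')%N) (le1 : (m + 2 <= r)%N)
  (le2 : (r * (3 * p) + m + 2 <= r' * p)%N) (le3 : (i <= m)%N).
Hypotheses (xi0 : xi != 0) (eta0 : eta != 0).
Hypothesis rel : xi ^+ (3 * p) * D x + eta ^+ p * D w = 0.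

Let f := D w / xi.

Let f_alt : f = - (xi ^+ (3 * p).-1 * D x) * eta^-1 ^+ p.
Proof.
have h : eta ^+ p * D w = - (xi ^+ (3 * p) * D x).
  by apply/eqP; rewrite -addr_eq0 addrC rel.
have e0 : eta ^+ p != 0 by exact: expf_neq0.
have x0 : xi != 0 by [].
apply: (mulfI e0); rewrite /f mulrA h exprVn.
have p3 : (0 < 3 * p)%N by rewrite muln_gt0.
rewrite -[in LHS](prednK p3) exprS; move: (xi ^+ _) (eta ^+ p) e0 => a c e0.
by field; rewrite x0 e0.
Qed.

Let pole_inv z : z \notin V -> [/\ z != 0, z^-1 \in V & D z = - z ^+ 2 * D z^-1].
Proof.
move=> zV; have z0 : z != 0 by apply: contraNneq zV => ->; rewrite rpred0.
split=> //; first by case: (vV z) => //; rewrite (negbTE zV).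
by rewrite (derV dD); field.
Qed.

(** Wherever [x] and [w] lie with respect to [V], one of the two expressions of [f] has a harmless
    denominator. As [d * D] is controlled on [V] only, at common poles the derivatives are rewritten
    through those of the inverses. *)
Lemma val_estimate : d * (f * x ^+ i) \in V.
Proof.
have r1 : (1 < r)%N := leq_trans (leq_addl m 2) le1.
have r'1 : (1 < r')%N := gt1_of_degree_le p_gt0 r1 le2.
have [xV|xV] := boolP (x \in V); have [wV|wV] := boolP (w \in V).
- have xiV : xi \in V by rewrite rpredD ?rpredX.
  have etaV : eta \in V by rewrite rpredD ?rpredX.
  rewrite mulrA; apply: rpredM; last exact: rpredX.
  (* If [eta] is a multiple of [xi ^+ 2] in [V], its derivative [D w] keeps the factor [xi] that
     cancels the denominator of [f]. *)
  have [zV|zV] := vV (eta / xi ^+ 2).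
    set z := eta / xi ^+ 2 in zV.
    have ez : eta = xi * xi * z by rewrite /z expr2; field.
    have Dw : D w = (D x * xi + xi * D x) * z + xi * xi * D z.
      by rewrite -(der_add_exp w pr') -/eta ez !(derM dD) (der_add_exp x pr).
    have -> : d * f = (d * D x) * z *+ 2 + xi * (d * D z).
      by rewrite /f Dw mulr2n; move: (D x) (D z) => a c; field.
    apply: rpredD; first by apply: rpredMn; apply: rpredM => //; exact: hV.
    by apply: rpredM => //; exact: hV.
  (* Otherwise 2p of the 3p - 1 factors [xi] in [f_alt] absorb the denominator [eta ^+ p]. *)
  rewrite invf_div in zV.
  have -> : d * f = - (xi ^+ 2 / eta) ^+ p * xi ^+ p.-1 * (d * D x).
    rewrite f_alt exprMn -!mulrA mulrCA !mulNr; congr (- _).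
    rewrite (pred_mul3 p_gt0) exprD exprM;
      move: (xi ^+ 2 ^+ p) (xi ^+ p.-1) (eta^-1 ^+ p) (D x) => a1 a2 a3 a4; ring.
  apply: rpredM; last exact: hV.
  by apply: rpredM; rewrite ?rpredN; exact: rpredX.
- have [u [u' [uV u'V eu _]]] := pole_add_exp wV r'1; have [w0 iwV _] := pole_inv wV.
  rewrite f_alt -/eta; have -> : eta^-1 = w^-1 ^+ r' * u by [].
  have -> : d * (- (xi ^+ (3 * p).-1 * D x) * (w^-1 ^+ r' * u) ^+ p * x ^+ i) =
    - xi ^+ (3 * p).-1 * (w^-1 ^+ r' * u) ^+ p * x ^+ i * (d * D x).
    by move: (xi ^+ _) (_ ^+ p) (x ^+ i) (D x) => a1 a2 a3 a4; ring.
  apply: rpredM; last exact: hV.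
  apply: rpredM; last exact: rpredX.
  apply: rpredM; first by rewrite rpredN rpredX // rpredD ?rpredX.
  by apply: rpredX; apply: rpredM => //; exact: rpredX.
- have [u [u' [uV u'V eu _]]] := pole_add_exp xV r1; have [x0 ixV _] := pole_inv xV.
  have le : (i <= r)%N := leq_trans le3 (leq_trans (leq_addr 2 m) le1).
  have -> : d * (f * x ^+ i) = (d * D w) * x^-1 ^+ (r - i) * u.
    rewrite /f eu; have -> : x^-1 ^+ r = x^-1 ^+ (r - i) * x^-1 ^+ i by rewrite -exprD subnK.
    have : x^-1 ^+ i * x ^+ i = 1 by rewrite -exprMn mulVf // expr1n.
    move: (x^-1 ^+ i) (x^-1 ^+ (_ - _)) (x ^+ i) (D w) => a1 a2 a3 a4 h.
    by transitivity (d * a4 * a2 * u * (a1 * a3)); [ring | rewrite h mulr1].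
  by apply: rpredM => //; apply: rpredM; [exact: hV | exact: rpredX].
have [u [u' [uV u'V eu eu']]] := pole_add_exp xV r1; have [x0 ixV Dx] := pole_inv xV.
have [v [v' [vV' v'V ev ev']]] := pole_add_exp wV r'1; have [w0 iwV Dw] := pole_inv wV.
(* The worse pole decides. If it is that of [x], the factor [x^-1 ^+ r] from [1 / xi] pays for
   [w ^+ 2] and [x ^+ i]; if it is that of [w], the factor [w^-1 ^+ (r' * p)] from [eta] pays for
   all powers of [x]. *)
have [qV|qV] := vV (w / x).
  have le : (2 + i <= r)%N by rewrite addnC (leq_trans _ le1) // leq_add2r.
  have -> : d * (f * x ^+ i) = - (w / x) ^+ 2 * (d * D w^-1) * x^-1 ^+ (r - (2 + i)) * u.
    rewrite /f eu Dw.
    have -> : x^-1 ^+ r = x^-1 ^+ (r - (2 + i)) * (x^-1 ^+ 2 * x^-1 ^+ i) by rewrite -!exprD subnK.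
    have : x^-1 ^+ i * x ^+ i = 1 by rewrite -exprMn mulVf // expr1n.
    move: (x^-1 ^+ i) (x^-1 ^+ (_ - _)) (x ^+ i) (D w^-1) => a1 a2 a3 a4 h.
    by transitivity (- (w / x) ^+ 2 * (d * a4) * a2 * u * (a1 * a3)); [ring | rewrite h mulr1].
  apply: rpredM => //; apply: rpredM; last exact: rpredX.
  by apply: rpredM; [rewrite rpredN; exact: rpredX | exact: hV].
rewrite invf_div in qV.
(* The total power of [x] to be paid for: [r * (3 * p).-1] from [xi], 2 from [D x], and [i]. *)
pose N := (r * (3 * p).-1 + (2 + i))%N.
have le : (N <= r' * p)%N.
  rewrite /N; apply: leq_trans le2; rewrite -addnA [(m + 2)%N]addnC.
  by apply: leq_add; [rewrite leq_mul2l leq_pred orbT | rewrite leq_add2l].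
have -> : d * (f * x ^+ i) =
  (x / w) ^+ N * w^-1 ^+ (r' * p - N) * u' ^+ (3 * p).-1 * v ^+ p * (d * D x^-1).
  rewrite f_alt -/eta -/xi Dx; have -> : eta^-1 = w^-1 ^+ r' * v by [].
  have -> : xi = x ^+ r * u' by [].
  rewrite !exprMn -!exprM.
  have -> : w^-1 ^+ (r' * p) = w^-1 ^+ (r' * p - N) * w^-1 ^+ N by rewrite -exprD subnK.
  have -> : x ^+ N = x ^+ (r * (3 * p).-1) * (x ^+ 2 * x ^+ i) by rewrite -!exprD.
  move: (x ^+ (r * _)) (x ^+ i) (w^-1 ^+ N) (w^-1 ^+ (_ - _))
    (u' ^+ _) (v ^+ p) (D x^-1) => *; ring.
apply: rpredM; last exact: hV.
by do 3! [apply: rpredM; last exact: rpredX]; exact: rpredX.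
Qed.

End Estimate.

(** For [P] of degree at most m this is t^m P(1/t), which translates the chart at [b^-1] into
    polynomials in [b]. *)
Definition revp (F : fieldType) m (P : {poly F}) := \poly_(i < m.+1) P`_(m - i).

(** * From the pole estimate to vanishing partial derivatives *)

Section KeyBound.
Variables (K : fieldType) (p : nat) (chK : p \in [pchar K]).
Variables (C0 : divringClosed K) (s I : seq K) (D : K -> K -> K).
Hypotheses (perf : forall x, x \in C0 -> exists2 y, y \in C0 & x = y ^+ p)
  (gens : forall z, z \in gen C0 s).
Hypotheses (uI : uniq I) (genI : forall z, z \in gen (Kp chK) I)
  (indI : forall b, b \in I -> b \notin gen (Kp chK) (rem b I)).
Hypothesis hD : forall b, b \in I -> derivation (D b) /\
  forall P : {poly K}, P \is a polyOver (gen (Kp chK) (rem b I)) -> D b P.[b] = P^`().[b].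

Section OneVariable.
Variable b : K.
Hypothesis bI : b \in I.

Let L := gen C0 (rem b I).
Let M := gen C0 I.
Let Db := D b.
Let dD : derivation Db. Proof. by case: (hD bI). Qed.

Definition evt (a : K) : {rmorphism {poly (subfield_of L)} -> K} :=
  (horner_eval a \o map_poly subfield_inj)%FUN.

Lemma evtE a P : evt a P = (map_poly subfield_inj P).[a].
Proof. by []. Qed.

Let evtC a c : evt a c%:P = subfield_inj c.
Proof. by rewrite evtE map_polyC hornerC. Qed.

Let evtX a : evt a 'X = a.
Proof. by rewrite evtE map_polyX hornerX. Qed.

Let evt_over a (P : {poly K}) : P \is a polyOver L -> exists Q, P.[a] = evt a Q.
Proof. by move=> /polyOver_subfield[Q ->]; exists Q; rewrite evtE. Qed.

Let LM : {subset L <= M}.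
Proof.
apply: gen_subset => x; first exact: gen_sub.
by move=> /mem_rem xI; exact: gen_mem.
Qed.

Let DL x : x \in L -> Db x = 0.
Proof.
move=> xL; apply: (partial_kb hD bI); move: x xL; apply: gen_subset; last exact: gen_mem.
by move=> x /perf[y _ ->]; apply/gen_sub/Kp_frob.
Qed.

Let evt_inj a P : Db a != 0 -> evt a P = 0 -> P = 0.
Proof.
move=> Da h; apply/eqP; rewrite -(map_poly_eq0 subfield_inj); apply/eqP.
exact: (partial_transc uI indI hD perf bI Da (map_subfield_over P)).
Qed.

Let evt_M a P : a \in M -> evt a P \in M.
Proof.
move=> aM; rewrite evtE; apply: rpred_horner => //.
by apply/polyOverP=> i; rewrite coef_map; apply/LM/subfield_injP.
Qed.

Let M_frac a x : b \in gen L [:: a] -> x \in M ->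
  exists P Q, Q != 0 /\ x * evt a Q = evt a P.
Proof.
move=> ba xM.
have /gen1_frac[P [Q [hP hQ Q0 ->]]] : x \in gen L [:: a].
  move: x xM; apply: gen_subset => x hx; first by apply/gen_sub/gen_sub.
  have [->//|xb] := eqVneq x b.
  by apply/gen_sub/gen_mem; rewrite mem_rem_uniq // inE xb.
have [P' eP] := evt_over a hP; have [Q' eQ] := evt_over a hQ.
exists P', Q'; rewrite -eP -eQ divfK //; split=> //.
by apply: contraNneq Q0 => h; rewrite eQ h rmorph0.
Qed.

(** [maclane] keeps a basis independent under Frobenius, and equal cardinality makes its p-th powers
    span again. *)
Let basis : exists n (e : 'I_n -> K), [/\ forall z, z \in span M e,
  forall z, z \in span M (fun i => e i ^+ p)
  & forall k, indep M (fun i => e i ^+ (p ^ k))].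
Proof.
have [n [e [he ie]]] := finite_basis (finite_over_pbasis gens genI).
have iq k : indep M (fun i => e i ^+ (p ^ k)).
  elim: k => [|k IH];
    first by rewrite expn0; move: ie; congr indep; apply/funext=> i; rewrite expr1.
  have := maclane uI indI perf uI (fun x h => h) IH.
  by congr indep; apply/funext=> i; rewrite -exprM -expnSr.
exists n, e; split=> //; apply: indep_span he _ => //.
by have := iq 1%N; rewrite expn1.
Qed.

Let b_der : Db b = 1. Proof. exact: (partial_self hD bI). Qed.

Let b0 : b != 0.
Proof. by apply/eqP=> h; move/eqP: b_der; rewrite h (der0 dD) eq_sym oner_eq0. Qed.

Let bM : b \in M. Proof. exact: gen_mem. Qed.

Let biM : b^-1 \in M. Proof. by rewrite rpredV. Qed.

Let Dbi : Db b^-1 = evt b^-1 (- 'X^2).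
Proof. by rewrite (derV dD) b_der rmorphN rmorphXn evtX exprVn mulN1r. Qed.

Let Dbi0 : Db b^-1 != 0.
Proof. by rewrite (derV dD) b_der mulN1r oppr_eq0 invr_eq0 expf_neq0. Qed.

(** Serves at [a = b] with [T = 1] and at [a = b^-1] with [T = - 'X^2]. Every valuation ring of [K]
    containing [L] lies over at least one of these two charts. *)
Let chart n (e : 'I_n -> K) a T : (forall z, z \in span M e) ->
  (forall z, z \in span M (fun i => e i ^+ p)) ->
  (forall k, indep M (fun i => e i ^+ (p ^ k))) ->
  a \in M -> Db a != 0 -> b \in gen L [:: a] -> Db a = evt a T ->
  (exists2 c, c != 0 & forall u, regular (evt a) u -> lat (evt a) e (evt a c * u)) /\
  (exists2 d, d != 0 & forall V z, over_chart (evt a) V -> z \in V -> evt a d * Db z \in V).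
Proof.
move=> h1 h2 h3 aM Da ba eT; split.
  by apply: (@conductor _ _ (evt a) p chK _ M) => // [P|P|x];
    [exact: evt_inj|exact: evt_M|exact: M_frac].
apply: (@der_valring _ _ (evt a) p chK _ M _ _ n e _ _ _ Db dD _ T) => //.
- by move=> P; exact: evt_inj.
- by move=> P; exact: evt_M.
- by move=> x; exact: M_frac.
- by move=> c; rewrite evtC DL // subfield_injP.
- by rewrite evtX.
Qed.

Let evt_rev m (P : {poly subfield_of L}) : (size P <= m)%N ->
  b ^+ m * evt b^-1 P = evt b (revp m P).
Proof.
move=> sP; rewrite !evtE (@horner_coef_wide _ m.+1); last first.
  by rewrite size_map_poly (leq_trans sP).
rewrite [RHS](@horner_coef_wide _ m.+1); last by rewrite size_map_poly size_poly.
rewrite mulr_sumr [RHS](reindex_inj rev_ord_inj); apply: eq_bigr => i _.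
have im : (i <= m)%N by rewrite -ltnS.
have er : (rev_ord i : nat) = (m - i)%N by rewrite /= subSS.
rewrite !coef_map coef_poly er ltnS leq_subr subKn // mulrCA; congr (_ * _).
have -> : b ^+ m = b ^+ (m - i) * b ^+ i by rewrite -exprD subnK.
by rewrite -mulrA -exprMn mulfV // expr1n mulr1.
Qed.

Let revp_neq0 (F : fieldType) m (P : {poly F}) : (size P <= m)%N -> P != 0 -> revp m P != 0.
Proof.
move=> sP; apply: contra => /eqP/polyP h; apply/eqP/polyP=> i; rewrite coef0.
have [le|lt] := leqP i m; last by rewrite nth_default // (leq_trans sP) // ltnW.
by have := h (m - i)%N; rewrite coef0 coef_poly ltnS leq_subr subKn.
Qed.

(** Poles bounded on both charts confine [evt b A * (f * x ^+ i)] to an [L]-space spanned by [n * N]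
    elements: n basis vectors with polynomial coordinates of size at most [N]. Taking [i] from 0 to
    [n * N] gives a linear relation; divided by the common factor it is an algebraic equation of [x]
    over [L], which [partial_transc] forbids. *)
Let sections_bound d1 d2 : d1 != 0 -> d2 != 0 -> exists B, forall f x, f != 0 -> Db x != 0 ->
  ~ forall i, (i <= B)%N -> regular (evt b) (evt b d1 * (f * x ^+ i)) /\
      regular (evt b^-1) (evt b^-1 d2 * (f * x ^+ i)).
Proof.
move=> d10 d20; have [n [e [h1 h2 h3]]] := basis.
have Db0 : Db b != 0 by rewrite b_der oner_neq0.
have [||[c1 c10 hc1] _] := chart h1 h2 h3 bM Db0 (T := 1).
- by rewrite gen_mem ?mem_head.
- by rewrite rmorph1.
have [||[c2 c20 hc2] _] := chart h1 h2 h3 biM Dbi0 (T := - 'X^2).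
- by rewrite -[X in X \in _]invrK rpredV gen_mem ?mem_head.
- exact: Dbi.
pose A := c1 * d1; pose B := c2 * d2; pose m := size B.
have A0 : A != 0 by rewrite mulf_neq0.
have B0 : B != 0 by rewrite mulf_neq0.
pose N := (m + size A)%N.
exists (n * N)%N => f x f0 Dx hreg.
have key i : (i <= n * N)%N -> evt b A * (f * x ^+ i) \in
    span L (fun kl : 'I_n * 'I_N => b ^+ kl.2 * e kl.1).
  move=> le; have [/hc1[P eP] /hc2[Q eQ]] := hreg i le.
  rewrite !mulrA -!rmorphM -/A -/B -!mulrA in eP eQ.
  set y := f * x ^+ i in eP eQ *.
  pose k := \max_l size (Q l).
  have sQ l : (size (Q l) <= k)%N by exact: (leq_bigmax_cond (F := fun l => size (Q l))).
  (* Multiplication by [b ^+ k * b ^+ m] turns the expansion at [b^-1] into one with coefficients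
     polynomial in [b], so that coordinates can be compared. *)
  have eQ' : evt b ('X^k * revp m B) * y = \sum_l evt b ('X^m * revp k (Q l)) * e l.
    rewrite rmorphM rmorphXn evtX -evt_rev //.
    have -> : b ^+ k * (b ^+ m * evt b^-1 B) * y =
      b ^+ k * b ^+ m * (evt b^-1 B * y) by rewrite !mulrA.
    rewrite eQ mulr_sumr; apply: eq_bigr => l _.
    by rewrite rmorphM rmorphXn evtX -evt_rev // !mulrA [b ^+ k * _]mulrC.
  have eqP l : 'X^k * revp m B * P l = 'X^m * A * revp k (Q l).
    have := h3 0%N (fun l => evt b ('X^k * revp m B * P l - 'X^m * A * revp k (Q l))).
    move=> /(_ (fun l => evt_M _ bM)) h; apply/eqP; rewrite -subr_eq0; apply/eqP.
    apply: (evt_inj Db0); move: l; apply: h.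
    transitivity (evt b ('X^k * revp m B) * (\sum_l evt b (P l) * e l) -
       evt b A * (\sum_l evt b ('X^m * revp k (Q l)) * e l)).
      rewrite !mulr_sumr -sumrB; apply: eq_bigr => l _.
      rewrite expn0 expr1 rmorphB mulrBl; congr (_ - _); first by rewrite rmorphM mulrA.
      by rewrite [RHS]mulrA -rmorphM; congr (evt b _ * _); rewrite -[LHS]mulrA [LHS]mulrCA.
    by rewrite -eP -eQ' mulrCA subrr.
  (* The reversed [Q l] has size at most [k + 1], so [k], which depends on [f], [x] and [i], cancels
     against ['X^k]; what remains is a bound in terms of [A] and [m]. *)
  have sP l : (size (P l) <= N)%N.
    have [->|P0] := eqVneq (P l) 0; first by rewrite size_poly0.
    have rB0 : revp m B != 0 by exact: revp_neq0.
    have XB0 : 'X^k * revp m B != 0 by rewrite mulf_neq0 // -size_poly_gt0 size_polyXn.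
    have XA0 : 'X^m * A != 0 by rewrite mulf_neq0 // -size_poly_gt0 size_polyXn.
    have rQ0 : revp k (Q l) != 0.
      by have := mulf_neq0 XB0 P0; rewrite eqP mulf_eq0 negb_or => /andP[].
    have := congr1 (fun R : {poly _} => size R) (eqP l) => /=.
    rewrite size_mul // [in X in _ = X]size_mul // ['X^k * _]mulrC ['X^m * _]mulrC !size_mulXn //.
    by apply: size_cancel_le; rewrite ?size_poly_gt0 //; exact: size_poly.
  rewrite eP; apply: rpred_sum => l _; rewrite evtE (@horner_coef_wide _ N) ?size_map_poly //.
  rewrite mulr_suml; apply: rpred_sum => q _; rewrite -mulrA; apply: span_scale.
    by rewrite coef_map subfield_injP.
  exact: (span_mem L (fun kl : 'I_n * 'I_N => b ^+ kl.2 * e kl.1) (l, q)).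
have [|i|c [hc [i0 ci0] c0]] := @steinitz K L [the finType of ('I_n * 'I_N)%type] 'I_(n * N).+1 _
    (fun i => evt b A * (f * x ^+ i)) _ (fun i => key i _).
- by rewrite card_prod !card_ord.
- by rewrite -ltnS.
pose R := \poly_(i < (n * N).+1) c (inord i).
have eR (i : 'I_(n * N).+1) : R`_i = c i by rewrite coef_poly ltn_ord inord_val.
have R0 : R = 0.
  apply: (partial_transc uI indI hD perf bI Dx).
    apply/polyOverP=> i; rewrite coef_poly; case: ifP => // _; exact: rpred0.
  have Af : evt b A * f != 0.
    by rewrite mulf_neq0 //; apply: contraNneq A0 => /(evt_inj Db0)->.
  apply: (mulfI Af); rewrite mulr0 -[RHS]c0 (@horner_coef_wide _ (n * N).+1) ?size_poly //.
  rewrite mulr_sumr; apply: eq_bigr => i _; rewrite eR.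
  by rewrite mulrCA !mulrA.
by move: ci0; rewrite -eR R0 coef0 eqxx.
Qed.

(** Quantifying over all large [r] and [r'] makes the property monotone in [m], so that one pair of
    exponents can serve the whole p-basis. *)
Definition key_bound m := forall r r' x w, (p %| r)%N -> (p %| r')%N -> (m + 2 <= r)%N ->
  (r * (3 * p) + m + 2 <= r' * p)%N ->
  (x + x ^+ r) ^+ (3 * p) * Db x + (w + w ^+ r') ^+ p * Db w = 0 -> Db x = 0.

Lemma key_bound_leq m m' : (m <= m')%N -> key_bound m -> key_bound m'.
Proof.
move=> le h r r' x w pr pr' le1 le2; apply: h => //.
  by apply: leq_trans le1; rewrite leq_add2r.
by apply: leq_trans le2; rewrite leq_add2r leq_add2l.
Qed.

Lemma exists_key_bound : exists m, key_bound m.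
Proof.
have [n [e [h1 h2 h3]]] := basis.
have Db0 : Db b != 0 by rewrite b_der oner_neq0.
have [||_ [d1 d10 hd1]] := chart h1 h2 h3 bM Db0 (T := 1).
- by rewrite gen_mem ?mem_head.
- by rewrite rmorph1.
have [||_ [d2 d20 hd2]] := chart h1 h2 h3 biM Dbi0 (T := - 'X^2).
- by rewrite -[X in X \in _]invrK rpredV gen_mem ?mem_head.
- exact: Dbi.
have [m hm] := sections_bound d10 d20; exists m => r r' x w pr pr' le1 le2 rel.
apply/eqP/negPn/negP => Dx.
have xi0 : x + x ^+ r != 0.
  by apply: contraNneq Dx => h; rewrite -(der_add_exp chK dD x pr) h (der0 dD).
have Dw : (w + w ^+ r') ^+ p * Db w != 0.
  apply: contraNneq Dx => h; move/eqP: rel; rewrite h addr0 mulf_eq0 expf_eq0.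
  by rewrite (negbTE xi0) andbF.
have p_gt0 : (0 < p)%N by apply: prime_gt0; case/andP: chK.
move: (Dw); rewrite mulf_eq0 negb_or expf_eq0 p_gt0 /= => /andP[eta0 Dw0].
apply: (hm (Db w / (x + x ^+ r)) x) => //; first by rewrite mulf_neq0 ?invr_eq0.
move=> i le; split=> V oV.
  by apply: (val_estimate chK dD _ _ pr pr' le1 le2 le xi0 eta0 rel);
    [case: oV | move=> z; exact: hd1].
by apply: (val_estimate chK dD _ _ pr pr' le1 le2 le xi0 eta0 rel);
  [case: oV | move=> z; exact: hd2].
Qed.

End OneVariable.

Definition pairing r r' (x w : K) := x * (x + x ^+ r) ^+ (3 * p) + w * (w + w ^+ r') ^+ p.

Lemma pairing_Kp : exists r r', forall x w,
  pairing r r' x w \in Kp chK -> x \in Kp chK /\ w \in Kp chK.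
Proof.
have p_gt0 : (0 < p)%N by apply: prime_gt0; case/andP: chK.
have [N hN] : exists N, forall b, b \in I -> key_bound b N.
  have : forall b, b \in I -> exists m, key_bound b m by move=> b bI; exact: exists_key_bound.
  elim: (I) => [|a J IH] hJ; first by exists 0%N.
  have [|N1 h1] := IH; first by move=> b bJ; apply: hJ; rewrite inE bJ orbT.
  have [N2 h2] := hJ a (mem_head _ _).
  exists (N1 + N2)%N => b; rewrite inE => /predU1P[->|/h1].
    by apply: key_bound_leq h2; rewrite leq_addl.
  by apply: key_bound_leq; rewrite leq_addr.
(* Multiples of p large enough for both inequalities of [key_bound] at [N]. *)
pose r := (p * (N + 2))%N; pose r' := (p * (r * (3 * p) + N + 2))%N.
exists r, r' => x w h.
have pr : (p %| r)%N by rewrite dvdn_mulr.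
have pr' : (p %| r')%N by rewrite dvdn_mulr.
have xK : x \in Kp chK.
  apply: (partials_Kp uI genI indI hD) => b bI; have dD := (hD bI).1.
  apply: (hN b bI r r' x w) => //.
  - by rewrite leq_pmull.
  - by rewrite /r' mulnAC leq_pmull // muln_gt0 p_gt0.
  have [y ey] := KpP chK _ h; have := der_pchar dD y chK; rewrite -ey /pairing.
  rewrite (derD dD) !(derM dD) exprM !(der_pchar dD _ chK) !mulr0 !addr0 => <-.
  by rewrite mulrC [D b w * _]mulrC.
split=> //.
(* With [x] settled, w eta^p is a p-th power and eta can be divided out unless it is 0; in that case
   [w = - w ^+ r'], a p-th power since p divides [r']. *)
have [e0|e0] := eqVneq (w + w ^+ r') 0.
  move/eqP: e0; rewrite addr_eq0 => /eqP->; rewrite rpredN.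
  by rewrite /r' mulnC exprM; exact: Kp_frob.
have : w * (w + w ^+ r') ^+ p \in Kp chK.
  have -> : w * (w + w ^+ r') ^+ p = pairing r r' x w - x * (x + x ^+ r) ^+ (3 * p).
    by rewrite /pairing addrAC subrr add0r.
  by rewrite rpredB // rpredM // exprM Kp_frob.
by rewrite rpredMr ?Kp_frob // unitfE expf_neq0.
Qed.

End KeyBound.

(** * Formulas *)

Section PowerPairing.
Variables (K : fieldType) (p : nat) (chK : p \in [pchar K]) (r r' : nat).
Hypothesis pairingK : forall x w : K,
  pairing p r r' x w \in Kp chK -> x \in Kp chK /\ w \in Kp chK.

Definition is_power q (x : K) := exists y, x = y ^+ q.

Lemma pairing_frob (x w : K) : pairing p r r' (x ^+ p) (w ^+ p) = pairing p r r' x w ^+ p.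
Proof.
rewrite /pairing [RHS]frobD // !exprMn; congr (_ * _ + _ * _).
  by rewrite [x ^+ p ^+ r]exprAC -frobD // exprAC.
by rewrite [w ^+ p ^+ r']exprAC -frobD.
Qed.

(** Once [x] and [w] are known to be p-th powers, [pairing_frob] and injectivity of Frobenius let a
    p-th root be taken throughout, which lowers [m]. *)
Lemma pairing_power m (x w : K) :
  is_power (p ^ m) (pairing p r r' x w) <-> is_power (p ^ m) x /\ is_power (p ^ m) w.
Proof.
elim: m x w => [|m IH] x w.
  by split=> _; [split|]; eexists; rewrite expn0 expr1.
split=> [[y ey]|[[a ea] [c ec]]].
  have [|/(KpP chK)[a ea] /(KpP chK)[c ec]] := @pairingK x w.
    by apply/KpP; exists (y ^+ (p ^ m)); rewrite ey expnSr exprM.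
  have [[a' ea'] [c' ec']] : is_power (p ^ m) a /\ is_power (p ^ m) c.
    apply/IH; exists y; apply: (frob_inj chK) => /=.
    by rewrite -pairing_frob -ea -ec ey expnSr exprM.
  by split; [exists a'; rewrite ea ea' | exists c'; rewrite ec ec']; rewrite expnSr exprM.
have [_ [|y ey]] := IH (a ^+ (p ^ m)) (c ^+ (p ^ m)); first by split; [exists a | exists c].
by exists y; rewrite ea ec expnSr !exprM pairing_frob ey.
Qed.

Lemma foldr_pairing_power m (s : seq K) :
  is_power (p ^ m) (foldr (pairing p r r') 0 s) <-> forall x, x \in s -> is_power (p ^ m) x.
Proof.
elim: s => [|x s IH] /=.
  split=> // _; exists 0; rewrite expr0n expn_eq0.
  by case/andP: chK => /prime_gt0; case: (p).
split=> [/pairing_power[hx /IH hs] y|h].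
  by rewrite inE => /predU1P[->|/hs].
apply/pairing_power; split; first by apply: h; rewrite mem_head.
by apply/IH => y ys; apply: h; rewrite inE ys orbT.
Qed.

End PowerPairing.

Lemma pairing_exists (p : nat) (K0 K : fieldType) (iota : {rmorphism K0 -> K})
    (charK0 : p \in [pchar K0]) (chK : p \in [pchar K]) :
  perfect_field K0 -> fin_gen_ext iota ->
  exists r r', forall x w : K,
    pairing p r r' x w \in Kp chK -> x \in Kp chK /\ w \in Kp chK.
Proof.
move=> perf [s hs].
pose Q : {pred K} := fun x => `[< exists a, x = iota a >].
have cQ : divring_closed Q.
  split; first by apply/asboolP; exists 1; rewrite rmorph1.
    by move=> _ _ /asboolP[a ->] /asboolP[c ->]; apply/asboolP; exists (a - c); rewrite rmorphB.
  by move=> _ _ /asboolP[a ->] /asboolP[c ->]; apply/asboolP; exists (a / c); rewrite fmorph_div.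
pose C0 : divringClosed K := HB.pack_for (divringClosed K) Q
  (GRing.isDivringClosed.Build K Q cQ).
have perfC x : x \in C0 -> exists2 y, y \in C0 & x = y ^+ p.
  case/asboolP=> a ->; have [c <-] := perf p charK0 a.
  by exists (iota c); [apply/asboolP; exists c | rewrite rmorphXn].
have gens z : z \in gen C0 s.
  elim: {z}(hs z) => [a|x xs|x y _ hx _ hy|x _ hx|x y _ hx _ hy|x _ hx].
  - by apply: gen_sub; apply/asboolP; exists a.
  - exact: gen_mem.
  - exact: rpredD.
  - by rewrite rpredN.
  - exact: rpredM.
  - by rewrite rpredV.
have [I [uI genI indI]] : exists I : seq K, [/\ uniq I, forall z, z \in gen (Kp chK) I
    & forall b, b \in I -> b \notin gen (Kp chK) (rem b I)].
  apply: (@exists_pbasis K p chK s) => z.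
  apply: (gen_subset _ (@gen_mem _ _ _) (gens z)) => x /perfC[y _ ->].
  exact/gen_sub/Kp_frob.
have [D hD] := exists_partial genI indI.
exact: (pairing_Kp perfC gens uI genI indI hD).
Qed.

(** * Satisfaction of quantifier blocks, conjunctions and closures *)

Section Semantics.
Variable M : lstructure.

Definition env_cat k n (u : 'I_k -> M) (v : 'I_n -> M) (i : 'I_(k + n)) : M :=
  match split i with inl a => u a | inr c => v c end.

Lemma env_cat_cons k n x (u : 'I_k -> M) (v : 'I_n -> M) :
  env_cons x (env_cat u v) = @env_cat k.+1 n (env_cons x u) v.
Proof.
apply/funext=> i; rewrite /env_cons /env_cat.
case: unliftP => [c ->|->].
  case: (splitP c) => a ea.
    have -> : lift ord0 c = lshift n (lift ord0 a) by apply: val_inj; rewrite /= ea.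
    by rewrite -[lshift n _]/(unsplit (inl _)) unsplitK liftK.
  have -> : lift ord0 c = rshift k.+1 a by apply: val_inj; rewrite /= /bump ea.
  by rewrite -[rshift _ _]/(unsplit (inr _)) unsplitK.
have -> : ord0 = lshift n (ord0 : 'I_k.+1) by exact: val_inj.
by rewrite -[lshift n _]/(unsplit (inl _)) unsplitK unlift_none.
Qed.

Lemma sat_exs k n (f : lformula (k + n)) (v : 'I_n -> M) :
  sat (exs f) v <-> exists u : 'I_k -> M, sat f (env_cat u v).
Proof.
elim: k f => [|k IH] f /=.
  have e0 (u : 'I_0 -> M) : env_cat u v = v.
    by apply/funext=> i; rewrite /env_cat; case: splitP => [[]//|c /val_inj->].
  split=> [h|[u]]; last by rewrite e0.
  by exists (@env_nil M); rewrite e0.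
rewrite IH; split=> [[u [x hx]]|[u hu]].
  by exists (env_cons x u); rewrite -env_cat_cons.
exists (fun i => u (lift ord0 i)), (u ord0).
rewrite env_cat_cons; move: hu; congr (sat f (env_cat _ v)).
by apply/funext=> i; rewrite /env_cons; case: unliftP => [c ->|->].
Qed.

Lemma sat_big_and n (I : eqType) (s : seq I) (F : I -> lformula n) (v : 'I_n -> M) :
  sat (\big[@FAnd n/FTop]_(i <- s) F i) v <-> forall i, i \in s -> sat (F i) v.
Proof.
elim: s => [|a s IH]; first by rewrite big_nil.
rewrite big_cons /=; split=> [[ha /IH hs] i|h].
  by rewrite inE => /predU1P[->|/hs].
split; first by apply: h; rewrite mem_head.
by apply/IH => i hi; apply: h; rewrite inE hi orbT.
Qed.

Lemma sat_univ_closure n (f : lformula n) :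
  (forall v : 'I_n -> M, sat f v) -> sat_sentence M (univ_closure f).
Proof.
elim: n f => [|n IH] f h /=; first exact: h.
by apply: IH => v /= x; exact: h.
Qed.

End Semantics.

(** * The two formulas interpreted in a field *)

Section RingTerms.
Variable K : fieldType.
Let M := ring_lstructure K.

Lemma teval_texp n (v : 'I_n -> M) t k : teval v (texp t k) = (teval v t : K) ^+ k.
Proof. by elim: k => [|k IH] //=; rewrite exprS -IH. Qed.

Definition tpairing p r r' n (a c : lterm n) : lterm n :=
  TAdd (TMul a (texp (TAdd a (texp a r)) (3 * p))) (TMul c (texp (TAdd c (texp c r')) p)).

Lemma teval_foldr_pairing p r r' n (v : 'I_n -> M) (s : seq (lterm n)) :
  teval v (foldr (@tpairing p r r' n) TZero s) = foldr (@pairing K p r r') 0 (map (@teval M n v) s).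
Proof. by elim: s => //= a s IH; rewrite !teval_texp /= !teval_texp IH. Qed.

Lemma sat_pi_formula n k (v : 'I_n -> M) :
  sat (pi_formula n k) v <-> forall i, is_power k (v i : K).
Proof.
rewrite /pi_formula sat_exs.
have ev u i : env_cat u v (rshift n i) = v i.
  by rewrite /env_cat -[rshift _ _]/(unsplit (inr _)) unsplitK.
have eu u i : env_cat u v (lshift n i) = u i.
  by rewrite /env_cat -[lshift _ _]/(unsplit (inl _)) unsplitK.
split=> [[u /sat_big_and h] i|h].
  by exists (u i); have := h i (mem_index_enum i); rewrite /= teval_texp /= ev eu.
have /choice[u hu] := h; exists u; apply/sat_big_and => i _ /=.
by rewrite teval_texp /= ev eu.
Qed.

Definition pairing_formula n p r r' q : lformula (1 + n) :=
  FEq (foldr (@tpairing p r r' (1 + n)) TZero [seq TVar (rshift 1 i) | i <- enum 'I_n])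
      (texp (TVar (lshift n ord0)) q).

Lemma sat_pairing_formula n p r r' q (v : 'I_n -> M) :
  sat (exs (pairing_formula n p r r' q)) v <->
  is_power q (foldr (@pairing K p r r') 0 [seq v i | i <- enum 'I_n]).
Proof.
rewrite sat_exs /=.
have e u : teval (env_cat u v)
  (foldr (@tpairing p r r' (1 + n)) TZero [seq TVar (rshift 1 i) | i <- enum 'I_n])
    = foldr (@pairing K p r r') 0 [seq v i | i <- enum 'I_n].
  rewrite teval_foldr_pairing -map_comp; congr foldr; apply: eq_map => i /=.
  by rewrite /env_cat -[rshift _ _]/(unsplit (inr _)) unsplitK.
split=> [[u hu]|[y ey]].
  exists (u ord0); rewrite -(e u) hu teval_texp /=.
  by rewrite /env_cat -[lshift _ _]/(unsplit (inl _)) unsplitK.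
exists (fun=> y); rewrite e teval_texp /= ey.
by rewrite /env_cat -[lshift _ _]/(unsplit (inl _)) unsplitK.
Qed.

End RingTerms.

(** [Th R] contains every sentence true in [R], so an equivalence checked in [R] alone holds in all
    models of the theory. *)
Lemma equiv_mod_Th (R : nzRingType) n (f g : lformula n) :
  (forall v : 'I_n -> ring_lstructure R, sat f v <-> sat g v) -> equiv_mod (Th R) f g.
Proof.
move=> h M modM; apply: modM; apply: sat_univ_closure => v.
by have [h1 h2] := h v; split.
Qed.

Local Close Scope ring_scope.

Theorem theorem5p10 (p : nat) (K0 K : fieldType) (iota : {rmorphism K0 -> K})
  (charK0 : p \in [pchar K0]%R) (perfK0 : perfect_field K0)
  (fgK : fin_gen_ext iota)
  (n m : nat) (n_gt0 : 0 < n) (m_gt0 : 0 < m) :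
  exrank_le (Th K) (pi_formula n (p ^ m)) 1.
Proof.
have chK : p \in [pchar K]%R by exact: rmorph_pchar charK0.
have [r [r' hp]] := pairing_exists charK0 chK perfK0 fgK.
exists (exs (pairing_formula n p r r' (p ^ m))); split.
  by exists 1%N, (pairing_formula n p r r' (p ^ m)).
apply: equiv_mod_Th => v.
rewrite sat_pi_formula sat_pairing_formula (foldr_pairing_power hp).
split=> [h x /mapP[i _ ->]|h i]; first exact: h.
by apply: h; rewrite map_f // mem_enum.
Qed.
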